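(* Let $p$ be an odd prime, let $n\ge 4$ be an even integer, and let $f:\mathbb{F}_p^n\to\mathbb{F}_p$ be a non-weakly regular bent function belonging to $\mathcal{DBF}$ such that $B_+(f)$ and $B_+(f^* )$ are both non-degenerate $r$-dimensional subspaces of $\mathbb{F}_p^n$ over $\mathbb{F}_p$. If $\frac n2+1\le r\le n-1$, then $$U_1=\{\{0\},\ B_+(f)^{\bot}\setminus\{0\},\ c_0(f)\setminus B_+(f)^{\bot},\ c_1(f),\dots,c_{p-1}(f),\ d_0(f),d_1(f),\dots,d_{p-1}(f)\}$$ is a partition of $\mathbb{F}_p^n$ and induces a $(2p+1)$-class symmetric association scheme.
   Context: Let $p$ be an odd prime, $n$ a positive integer, $x\cdot y$ the ordinary inner product on $\mathbb{F}_p^n$, and $\xi_p=e^{2\pi\sqrt{-1}/p}$. Bent functions. For $f:\mathbb{F}_p^n\to\mathbb{F}_p$ the Walsh transform is $\mathcal{W}_f(\alpha)=\sum_{x\in\mathbb{F}_p^n}\xi_p^{f(x)-\alpha\cdot x}$, $\alpha\in\mathbb{F}_p^n$; $f$ is bent if $|\mathcal{W}_f(\alpha)|=p^{n/2}$ for all $\alpha$. Put $\mu=1$ if $p^n\equiv1\pmod 4$ and $\mu=\sqrt{-1}$ if $p^n\equiv3\pmod4$. For a bent $f$ it is known that for every $\alpha$, $\mathcal{W}_f(\alpha)\in\{\mu p^{n/2}\xi_p^{f^*(\alpha)},-\mu p^{n/2}\xi_p^{f^*(\alpha)}\}$ for a (unique) function $f^*:\mathbb{F}_p^n\to\mathbb{F}_p$,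 called the dual of $f$. A bent $f$ is weakly regular if there is $\lambda\in\{\pm1,\pm\sqrt{-1}\}$ independent of $\alpha$ with $\mathcal{W}_f(\alpha)=\lambda p^{n/2}\xi_p^{f^*(\alpha)}$ for all $\alpha$; otherwise it is non-weakly regular. A bent $f$ is dual-bent if $f^*$ is also bent. For a bent function $f$: $B_+(f)=\{\alpha:\mathcal{W}_f(\alpha)=\mu p^{n/2}\xi_p^{f^*(\alpha)}\}$ and $B_-(f)=\{\alpha:\mathcal{W}_f(\alpha)=-\mu p^{n/2}\xi_p^{f^*(\alpha)}\}$. For $f$ dual-bent, $B_\pm(f^* )$ are defined by the same formulas applied to the bent function $f^*$. For dual-bent $f$ and $j\in\mathbb{F}_p$: $c_j(f)=\{x\in B_+(f^* ):f(x)=j\}$, $d_j(f)=\{x\in B_-(f^* ):f(x)=j\}$. $\mathcal{DBF}$ is the set of dual-bent functions $f:\mathbb{F}_p^n\to\mathbb{F}_p$ such that $f(0)=0$ and there is a positive integer $h$ with $\gcd(h-1,p-1)=1$ and $f(ax)=a^hf(x)$ for all $a\in\mathbb{F}_p^*$, $x\in\mathbb{F}_p^n$. For a subspace $V$ of $\mathbb{F}_p^n$, $V^\bot$ is its orthogonal complement with respect to $\cdot$; $V$ is non-degenerate if $\{x\in V:x\cdot y=0\ \text{for all } y\in V\}=\{0\}$. Association schemes. A $d$-class association scheme on a nonempty finite set $X$ is a partition of $X\times X$ into relations $R_0,\dots,R_d$ such that $R_0=\{(x,x):x\in X\}$; for each $j$ the transpose $R_j^T$ equals some $R_{j'}$;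 and for all $u,v,w$ and $(x,y)\in R_w$ the number $|\{z\in X:(x,z)\in R_u,(z,y)\in R_v\}|$ depends only on $u,v,w$. It is symmetric if $R_j^T=R_j$ for all $j$. A partition $\{U_i\}_{i=0}^d$ of $\mathbb{F}_p^n$ (into nonempty sets) with $U_0=\{0\}$ induces a $d$-class symmetric association scheme if the relations $R_i=\{(\alpha,\beta):\alpha-\beta\in U_i\}$, $0\le i\le d$, form a symmetric association scheme on $\mathbb{F}_p^n$. *)

(* Defs.v *)
From HB Require Import structures.
From mathcomp Require Import all_boot all_order all_algebra.
From mathcomp Require Import complex reals trigo.

Set Implicit Arguments.
Unset Strict Implicit.
Unset Printing Implicit Defensive.

Import GRing.Theory Num.Theory.

Local Open Scope ring_scope.
Local Open Scope complex_scope.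

(* Everything is meant for p prime: 'F_p is a field with p elements only then. *)

Section Bent.

Variables (R : realType) (p n : nat).
Implicit Types f : 'rV['F_p]_n -> 'F_p.

Definition dot (x y : 'rV['F_p]_n) : 'F_p := \sum_i x 0 i * y 0 i.

(* e^(2 pi i / p) *)
Definition xi : R[i] := cos (2 * pi / p%:R) +i* sin (2 * pi / p%:R).

Definition mu : R[i] := if (p ^ n == 1 %[mod 4])%N then 1 else 'i%C.

(* p^(n/2), also for n odd *)
Definition sqrtq : R[i] := (Num.sqrt (p%:R : R) ^+ n)%:C.

(* The exponents of xi are the representatives in {0, .., p-1} of elements of
   'F_p; xi is a p-th root of unity. *)
Definition walsh f (a : 'rV['F_p]_n) : R[i] :=
  \sum_(x : 'rV['F_p]_n) xi ^+ (f x - dot a x)%R.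

Definition bent f : Prop := forall a, `|walsh f a| = sqrtq.

(* For f bent (and p an odd prime), exactly one j satisfies the condition at
   each a, so that the default value 0 is never used. *)
Definition dual f (a : 'rV['F_p]_n) : 'F_p :=
  odflt 0 [pick j : 'F_p | (walsh f a == mu * sqrtq * xi ^+ j)
                        || (walsh f a == - (mu * sqrtq * xi ^+ j))].

Definition weakly_regular f : Prop :=
  bent f /\
  exists2 lambda : R[i], lambda \in [:: 1; -1; 'i%C; - 'i%C]
    & forall a, walsh f a = lambda * sqrtq * xi ^+ (dual f a).

Definition non_weakly_regular f : Prop := bent f /\ ~ weakly_regular f.

Definition dual_bent f : Prop := bent f /\ bent (dual f).

Definition Bplus f : {set 'rV['F_p]_n} :=
  [set a | walsh f a == mu * sqrtq * xi ^+ (dual f a)].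

Definition Bminus f : {set 'rV['F_p]_n} :=
  [set a | walsh f a == - (mu * sqrtq * xi ^+ (dual f a))].

Definition cset f (j : 'F_p) : {set 'rV['F_p]_n} :=
  [set x in Bplus (dual f) | f x == j].

Definition dset f (j : 'F_p) : {set 'rV['F_p]_n} :=
  [set x in Bminus (dual f) | f x == j].

Definition DBF f : Prop :=
  [/\ dual_bent f, f 0 = 0
    & exists h : nat, [/\ (0 < h)%N, coprime (h - 1) (p - 1)
        & forall (a : 'F_p) (x : 'rV['F_p]_n), a != 0 ->
            f (a *: x) = a ^+ h * f x]].

Definition orth (A : {set 'rV['F_p]_n}) : {set 'rV['F_p]_n} :=
  [set y | [forall x in A, dot x y == 0]].

Definition nondegenerate (A : {set 'rV['F_p]_n}) : Prop :=
  [set x in A | [forall y in A, dot x y == 0]] = [set 0].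

Definition nondeg_subspace (r : nat) (A : {set 'rV['F_p]_n}) : Prop :=
  exists V : {vspace 'rV['F_p]_n},
    [/\ A = [set x | x \in V], \dim V = r & nondegenerate A].

Definition U1 f : {set {set 'rV['F_p]_n}} :=
  [set [set 0]; orth (Bplus f) :\ 0; cset f 0 :\: orth (Bplus f)]
    :|: [set cset f j | j in 'F_p & j != 0]
    :|: [set dset f j | j in 'F_p].

End Bent.

Section AssociationScheme.

Definition transpose_rel (X : finType) (S : {set X * X}) : {set X * X} :=
  [set xy | (xy.2, xy.1) \in S].

(* Injectivity makes R_0, .., R_d pairwise distinct, hence pairwise disjoint. *)
Definition association_scheme (X : finType) (d : nat)
    (Rel : 'I_d.+1 -> {set X * X}) : Prop :=
  [/\ (0 < #|X|)%N,
      injective Rel /\ partition [set Rel i | i : 'I_d.+1] [set: X * X],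
      Rel ord0 = [set xy | xy.1 == xy.2],
      (forall j, exists j', transpose_rel (Rel j) = Rel j')
    & forall u v w, exists k : nat, forall x y, (x, y) \in Rel w ->
        #|[set z | ((x, z) \in Rel u) && ((z, y) \in Rel v)]| = k].

Definition symmetric_scheme (X : finType) (d : nat)
    (Rel : 'I_d.+1 -> {set X * X}) : Prop :=
  association_scheme Rel /\ forall j, transpose_rel (Rel j) = Rel j.

(* The partition P is given as an unordered collection; U is a numbering of its
   d + 1 (distinct) members that starts with {0}. *)
Definition induces_symmetric_scheme (V : finZmodType) (d : nat)
    (P : {set {set V}}) : Prop :=
  exists U : 'I_d.+1 -> {set V},
    [/\ injective U, P = [set U i | i : 'I_d.+1], U ord0 = [set 0]
      & symmetric_scheme (fun i => [set ab : V * V | ab.1 - ab.2 \in U i])].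

End AssociationScheme.

(* Main.v *)
(* Let g = f^*, A = B_+(f), B = B_+(g) and q = p^(n/2). Splitting the Fourier
   inversion of f over A and its complement, and comparing with the Walsh
   transform of g modulo 2 in Z[xi], gives g^*(x) = f(-x) = f(x) and
     \sum_(a in A) xi^(g(a) + a.x) = q xi^f(x) [x in B],
     \sum_(a notin A) xi^(g(a) + a.x) = - q xi^f(x) [x notin B],
   and the same with (f, B) and (g, A) exchanged. Galois conjugation and the
   homogeneity of f and g turn these into formulas for all exponents t g(a), so
   the Fourier transform maps functions constant on the classes
   {0}, B^\bot \ 0, c_j(g) \ B^\bot, d_j(g) to functions constant on the classes
   {0}, A^\bot \ 0, c_j(f) \ A^\bot, d_j(f), and conversely. The convolution of two
   classes is, up to a factor, the transform of the product of their transforms,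
   hence constant on classes: these constants are the intersection numbers. The
   bounds on r make all classes nonempty.

   That a bent function with n even has Walsh values +- q xi^j is proved by hand:
   q divides the value because p is totally ramified in Z[xi], and the quotient
   is a unit all of whose conjugates have absolute value 1. *)

Require Import Defs.
From mathcomp Require Import all_boot all_order all_algebra.
From mathcomp Require Import complex reals trigo.
From mathcomp Require Import perm finfield ring zify.

Set Implicit Arguments.
Unset Strict Implicit.
Unset Printing Implicit Defensive.

Import Order.TTheory GRing.Theory Num.Theory.
Local Open Scope ring_scope.

(** * Relations between roots of unity of prime order *)

Section Cyclotomic.
Variables (C : numClosedFieldType) (p : nat) (z : C).
Hypotheses (p_prime : prime p) (z_prim : p.-primitive_root z).

Local Notation ev x P := (map_poly (intr : int -> C) P).[x].
Local Notation Phi := (\sum_(i < p) 'X^i : {poly int}).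

(* Phi(X + 1), to which Eisenstein's criterion applies. *)
Let shPhi : {poly int} := \poly_(i < p) 'C(p, i.+1)%:R.

Let p_gt0 : (0 < p)%N := prime_gt0 p_prime.
Let p_gt1 : (1 < p)%N := prime_gt1 p_prime.

Lemma shPhiE : shPhi * 'X = ('X + 1) ^+ p - 1.
Proof.
rewrite exprD1n big_ord_recl /= expr0 bin0 mulr1n addrAC subrr add0r.
rewrite /shPhi poly_def mulr_suml; apply: eq_bigr => i _.
by rewrite -scalerAl -exprSr scaler_nat.
Qed.

Lemma size_shPhi : size shPhi = p.
Proof. by rewrite size_poly_eq // prednK // binn. Qed.

Lemma shPhi_monic : shPhi \is monic.
Proof.
by rewrite monicE lead_coefE size_shPhi coef_poly prednK // leqnn binn.
Qed.

Lemma shPhi_irreducible : irreducible_poly shPhi.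
Proof.
apply: (@eisenstein_crit p) => //.
- by rewrite size_shPhi neq_ltn p_gt1 orbT.
- rewrite (monicP shPhi_monic) dvdzE /= dvdn1.
  by rewrite neq_ltn p_gt1 orbT.
- rewrite coef_poly p_gt0 bin1 dvdzE /= natz absz_nat.
  by apply/negP => /dvdn_leq; move: p_gt1 p_gt0; nia.
- move=> i; rewrite size_shPhi => ltip.
  have lip : (i < p)%N by apply: leq_trans ltip (leq_pred p).
  rewrite coef_poly lip dvdzE /= natz absz_nat prime_dvd_bin //=.
  by rewrite -[X in (_ < X)%N](prednK p_gt0) ltnS.
Qed.

Lemma Phi_mul : Phi * ('X - 1) = 'X^p - 1.
Proof. by rewrite subrX1 mulrC. Qed.

Lemma shPhi_comp : shPhi \Po ('X - 1) = Phi.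
Proof.
have X1_neq0 : 'X - 1 != 0 :> {poly int} by rewrite monic_neq0 // monicXsubC.
apply: (mulIf X1_neq0); rewrite Phi_mul.
have := congr1 (fun P => P \Po ('X - 1)) shPhiE.
by rewrite comp_polyM comp_polyX => ->; rewrite rmorphB rmorphXn rmorphD !rmorph1
  /= comp_polyX subrK.
Qed.

Lemma prim_root_neq1 : z != 1.
Proof. by rewrite -(expr1 z) -(prim_order_dvd z_prim) dvdn1 neq_ltn p_gt1 orbT. Qed.

Lemma ev_shPhi : ev (z - 1) shPhi = 0.
Proof.
have z1 : z - 1 != 0 by rewrite subr_eq0 prim_root_neq1.
apply: (mulIf z1); rewrite mul0r.
have := congr1 (fun P => ev (z - 1) P) shPhiE.
rewrite rmorphM /= map_polyX hornerM hornerX => ->.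
rewrite rmorphB rmorphXn rmorphD /= map_polyX rmorph1.
by rewrite !hornerE subrK prim_expr_order // subrr.
Qed.

Lemma ev_compX1 (P : {poly int}) : ev (z - 1) (P \Po ('X + 1)) = ev z P.
Proof.
rewrite map_comp_poly horner_comp rmorphD /= map_polyX rmorph1 !hornerE.
by rewrite subrK.
Qed.

(** Over the rationals [shPhi] is irreducible; if it did not divide P, a Bezout identity evaluated
    at [z - 1] would read 0 = 1. Monicity brings the quotient back to integer coefficients. *)
Lemma shPhi_dvd (P : {poly int}) : ev (z - 1) P = 0 -> exists Q, P = Q * shPhi.
Proof.
move=> Pz0; apply/Pdiv.IdomainMonic.dvdpP; first exact: shPhi_monic.
have toQ (S : {poly int}) :
    ev (z - 1) S = (map_poly (ratr : rat -> C) (map_poly intr S)).[z - 1].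
  rewrite -map_poly_comp; congr _.[_]; apply: eq_map_poly => i /=.
  by rewrite ratr_int.
rewrite -dvdp_rat_int.
have irrQ := (irreducible_rat_int shPhi).2 shPhi_irreducible.
apply: contraT => ndvd.
have /Bezout_eq1_coprimepP [[u v] /= uv1] :
    coprimep (map_poly (intr : int -> rat) shPhi) (map_poly intr P).
  by rewrite irreducible_poly_coprime.
have := congr1 (fun S => (map_poly (ratr : rat -> C) S).[z - 1]) uv1.
rewrite rmorphD !rmorphM rmorph1 /= !hornerE -!toQ Pz0 ev_shPhi !mulr0 addr0.
by move/eqP; rewrite eq_sym oner_eq0.
Qed.

Lemma prim_root_dvd (P : {poly int}) : ev z P = 0 -> exists Q, P = Q * Phi.
Proof.
rewrite -ev_compX1 => /shPhi_dvd [Q PQ]; exists (Q \Po ('X - 1)).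
rewrite -shPhi_comp -comp_polyM -PQ -comp_polyA comp_polyD comp_polyX rmorph1.
by rewrite subrK comp_polyXr.
Qed.

Lemma sum_unity_root (x : C) : x ^+ p = 1 -> x != 1 -> \sum_(k < p) x ^+ k = 0.
Proof.
move=> xp; rewrite -subr_eq0 => x1; apply: (mulfI x1).
by rewrite mulr0 -subrX1 xp subrr.
Qed.

Lemma sum_prim_root k : ~~ (p %| k)%N -> \sum_(i < p) (z ^+ k) ^+ i = 0.
Proof.
move=> pk; apply: sum_unity_root; last by rewrite -(prim_order_dvd z_prim).
by rewrite exprAC (prim_expr_order z_prim) expr1n.
Qed.

Lemma ev_Phi x : ev x Phi = \sum_(i < p) x ^+ i.
Proof.
rewrite rmorph_sum horner_sum; apply: eq_bigr => i _.
by rewrite /= map_polyXn hornerXn.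
Qed.

(* The Galois conjugation z |-> z ^+ k, stated on integer relations. *)
Lemma prim_root_conjugate (P : {poly int}) k :
  ev z P = 0 -> ~~ (p %| k)%N -> ev (z ^+ k) P = 0.
Proof.
move=> /prim_root_dvd [Q ->] pk.
by rewrite rmorphM hornerM ev_Phi sum_prim_root // mulr0.
Qed.

(** Since [Phi] takes the value p at 1, [P.[1]] modulo p depends only on the value of P at z: this
    is the reduction modulo [z - 1]. *)
Lemma prim_root_augmentation (P : {poly int}) :
  ev z P = 0 -> exists c : int, P.[1] = c * p%:R.
Proof.
move=> /prim_root_dvd [Q ->]; exists Q.[1]; rewrite hornerM; congr (_ * _).
rewrite horner_sum (eq_bigr (fun=> 1)) ?sumr_const ?card_ord // => i _.
by rewrite hornerXn expr1n.
Qed.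

(** The relation is a polynomial of degree less than p divisible by [Phi], which has degree p - 1;
    so the quotient is a constant. *)
Lemma prim_root_relation (c : 'I_p -> int) :
  \sum_i (c i)%:~R * z ^+ i = 0 -> forall i j, c i = c j.
Proof.
move=> c0; pose P : {poly int} := \sum_i (c i) *: 'X^i.
have coefP (i : 'I_p) : P`_i = c i.
  rewrite coef_sum (bigD1 i) //= coefZ coefXn eqxx mulr1 big1 ?addr0 // => j ji.
  by rewrite coefZ coefXn eq_sym (inj_eq val_inj) (negPf ji) mulr0.
have [] : exists Q, P = Q * Phi.
  apply: prim_root_dvd; rewrite -[RHS]c0 rmorph_sum horner_sum /=.
  by apply: eq_bigr => i _; rewrite linearZ /= map_polyXn hornerZ hornerXn.
move=> Q PQ; have sP : (size P <= p)%N.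
  apply: (leq_trans (size_sum _ _ _)); apply/bigmax_leqP => i _.
  by apply: leq_trans (size_scale_leq _ _) _; rewrite size_polyXn.
have PhiE : Phi = \poly_(i < p) 1.
  by rewrite poly_def; apply: eq_bigr => i _; rewrite scale1r.
have sPhi : size Phi = p.
  by rewrite PhiE size_poly_eq // oner_neq0.
have Phi_mon : Phi \is monic.
  by rewrite monicE lead_coefE sPhi PhiE coef_poly prednK // leqnn.
have Qc : (size Q <= 1)%N.
  have [->|Q0] := eqVneq Q 0; first by rewrite size_poly0.
  move: sP; rewrite PQ size_Mmonic // sPhi -subn1 => sQ.
  by have := p_gt0; lia.
move: PQ; rewrite (size1_polyC Qc) mul_polyC => PQ i j.
by rewrite -!coefP PQ !coefZ PhiE !coef_poly !ltn_ord.
Qed.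

End Cyclotomic.

(** * Divisibility in the ring of cyclotomic integers *)

Section CyclotomicIntegers.
Variables (C : numClosedFieldType) (p : nat) (z : C).
Hypotheses (p_prime : prime p) (z_prim : p.-primitive_root z).

Local Notation ev x P := (map_poly (intr : int -> C) P).[x].
Local Notation lam := (z - 1).

Let p_gt0 : (0 < p)%N := prime_gt0 p_prime.
Let p_gt1 : (1 < p)%N := prime_gt1 p_prime.

Definition cyclint (x : C) := exists P : {poly int}, x = ev z P.

Definition cyclint_dvd (d x : C) := exists2 y, cyclint y & x = d * y.

Lemma cyclintD x y : cyclint x -> cyclint y -> cyclint (x + y).
Proof. by move=> [P ->] [Q ->]; exists (P + Q); rewrite rmorphD hornerD. Qed.

Lemma cyclintM x y : cyclint x -> cyclint y -> cyclint (x * y).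
Proof. by move=> [P ->] [Q ->]; exists (P * Q); rewrite rmorphM hornerM. Qed.

Lemma cyclint_int (c : int) : cyclint c%:~R.
Proof. by exists c%:P; rewrite map_polyC hornerC. Qed.

Lemma cyclint_nat (c : nat) : cyclint c%:R.
Proof. exact: cyclint_int c. Qed.

Lemma cyclintN x : cyclint x -> cyclint (- x).
Proof. by move=> [P ->]; exists (- P); rewrite rmorphN hornerN. Qed.

Lemma cyclint_root : cyclint z.
Proof. by exists 'X; rewrite map_polyX hornerX. Qed.

Lemma cyclintX x k : cyclint x -> cyclint (x ^+ k).
Proof. by move=> [P ->]; exists (P ^+ k); rewrite rmorphXn /= horner_exp. Qed.

Lemma cyclint_sum (I : Type) (r : seq I) (Q : pred I) (F : I -> C) :
  (forall i, Q i -> cyclint (F i)) -> cyclint (\sum_(i <- r | Q i) F i).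
Proof.
move=> QF; elim/big_rec: _ => [|i x Qi xZ]; first exact: cyclint_nat 0.
exact: cyclintD (QF i Qi) xZ.
Qed.

Lemma cyclint_dvdD d x y :
  cyclint_dvd d x -> cyclint_dvd d y -> cyclint_dvd d (x + y).
Proof.
by move=> [a aZ ->] [b bZ ->]; exists (a + b); rewrite ?mulrDr //; apply: cyclintD.
Qed.

Lemma cyclint_dvdMr d x y : cyclint_dvd d x -> cyclint y -> cyclint_dvd d (x * y).
Proof.
by move=> [a aZ ->] bZ; exists (a * y); rewrite ?mulrA //; apply: cyclintM.
Qed.

(** A root of unity has absolute value 1, so its conjugate is its inverse; writing the inverse as a
    power makes conjugation a polynomial substitution. *)
Lemma conj_prim_root k : (z ^+ k)^* = (z ^+ k) ^+ p.-1.
Proof.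
have z0 : z ^+ k != 0.
  apply/expf_neq0/eqP => z0; have := prim_expr_order z_prim.
  by rewrite z0 expr0n gtn_eqF // => /eqP; rewrite eq_sym oner_eq0.
have zp1 : (z ^+ k) ^+ p = 1.
  by rewrite exprAC (prim_expr_order z_prim) expr1n.
have nz1 : `|z ^+ k| = 1.
  by apply: (pexpIrn p_gt0); rewrite ?nnegrE // -normrX zp1 normr1 expr1n.
apply: (mulfI z0); rewrite -normCK nz1 expr1n -exprS prednK //.
Qed.

(** One substitution serves all k, so an identity involving complex conjugates is an integer
    relation to which [prim_root_conjugate] applies. *)
Lemma conj_ev k (P : {poly int}) : (ev (z ^+ k) P)^* = ev (z ^+ k) (P \Po 'X^(p.-1)).
Proof.
rewrite -horner_map map_comp_poly horner_comp /= map_polyXn hornerXn.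
rewrite conj_prim_root -map_poly_comp; congr _.[_].
by apply: eq_map_poly => i /=; rewrite rmorph_int.
Qed.

Lemma cyclint_conj x : cyclint x -> cyclint x^*.
Proof.
by move=> [P ->]; exists (P \Po 'X^(p.-1)); rewrite -[in LHS](expr1 z) conj_ev expr1.
Qed.

(* The reduction Z[z] -> Z[z] / (z - 1) = F_p, realised as P |-> P.[1]. *)
Lemma ev_augmentation (P : {poly int}) : cyclint_dvd lam (ev z P - (P.[1])%:~R).
Proof.
have /factor_theorem [Q PQ] : root (P - (P.[1])%:P) 1.
  by rewrite rootE !hornerE subr_eq0.
exists (ev z Q); first by exists Q.
have := congr1 (fun S => ev z S) PQ.
rewrite rmorphB rmorphM /= rmorphB /= !map_polyC map_polyX /= !hornerE => ->.
by rewrite mulrC.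
Qed.

(** If s = (z - 1) Q(z), the integer polynomial s - (X - 1) Q vanishes at z and takes the value s at
    1. *)
Lemma lam_dvd_int (s : int) : cyclint_dvd lam s%:~R -> (p %| s)%Z.
Proof.
move=> [_ [Q ->] sQ].
have /(prim_root_augmentation p_prime z_prim) [c] : ev z (s%:P - ('X - 1) * Q) = 0.
  rewrite rmorphB rmorphM /= rmorphB /= !map_polyC map_polyX /= rmorph1 !hornerE.
  by rewrite sQ subrr.
rewrite !hornerE => ->.
by rewrite natz; apply: dvdz_mull.
Qed.

(** Expand [shPhi] at [z - 1]: the extreme terms are p and [lam ^+ p.-1], and those between are
    divisible by p times [lam]. *)
Lemma lam_pow : exists2 y, cyclint y & lam ^+ p.-1 = - p%:R * (1 + lam * y).
Proof.
have [q pq] : exists q, p = q.+2 by case: p p_gt1 => [|[|q]] // _; exists q.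
have E : p%:R + (\sum_(i < q) ('C(p, i.+2))%:R * lam ^+ i.+1 + lam ^+ p.-1) = 0.
  rewrite -[RHS](ev_shPhi p_prime z_prim).
  rewrite (@horner_coef_wide _ q.+2); last first.
    by rewrite -pq (leq_trans (size_poly _ _)) // size_poly.
  rewrite big_ord_recl big_ord_recr /= !coef_map !coef_poly.
  rewrite /bump /= expr0 mulr1 !add1n pq ltnSn binn mul1r bin1 natz.
  congr (_ + (_ + _)); apply: eq_bigr => i _.
  by rewrite coef_map coef_poly !add1n /= !ltnS ltnW ?ltn_ord // natz.
exists (\sum_(i < q) ('C(p, i.+2) %/ p)%:R * lam ^+ i).
  apply: cyclint_sum => i _; apply: cyclintM; first exact: cyclint_nat.
  apply: cyclintX; apply: cyclintD; first exact: cyclint_root.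
  exact: cyclintN (cyclint_nat 1).
have S : p%:R * (lam * \sum_(i < q) ('C(p, i.+2) %/ p)%:R * lam ^+ i) =
         \sum_(i < q) ('C(p, i.+2))%:R * lam ^+ i.+1.
  rewrite !mulr_sumr; apply: eq_bigr => i _.
  have /dvdnP [c ->] : (p %| 'C(p, i.+2))%N.
    by apply: prime_dvd_bin => //=; rewrite pq !ltnS ltn_ord.
  by rewrite mulnK // exprS natrM; ring.
by apply/eqP; rewrite mulNr -addr_eq0 addrC mulrDr mulr1 S -addrA; apply/eqP.
Qed.

Lemma lam_neq0 : lam != 0.
Proof. by rewrite subr_eq0 (prim_root_neq1 p_prime z_prim). Qed.

Lemma cyclint_lam : cyclint lam.
Proof. exact: cyclintD cyclint_root (cyclintN (cyclint_nat 1)). Qed.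

Lemma p_dvd_lam_pow : cyclint_dvd p%:R (lam ^+ p.-1).
Proof.
have [y yZ ->] := lam_pow; exists (- (1 + lam * y)); last by ring.
apply: cyclintN; apply: cyclintD; first exact: cyclint_nat 1.
exact: cyclintM cyclint_lam yZ.
Qed.

(** By [lam_pow], p equals [- lam ^+ p.-1 - p%:R * lam * y], so a factor [lam ^+ k] of p with k < p
    - 1 improves to [lam ^+ k.+1]. This avoids inverting [1 + lam * y]. *)
Lemma lam_pow_dvd_p : cyclint_dvd (lam ^+ p.-1) p%:R.
Proof.
have [y yZ E] := lam_pow.
suff: forall k, (k <= p.-1)%N -> cyclint_dvd (lam ^+ k) p%:R by apply.
elim=> [|k IH] ltk; first by exists p%:R; rewrite ?mul1r //; apply: cyclint_nat.
have [w wZ pw] := IH (ltnW ltk).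
exists (- (lam ^+ (p.-1 - k.+1) + y * w)).
  apply/cyclintN/cyclintD; last exact: cyclintM.
  exact/cyclintX/cyclint_lam.
have -> : lam ^+ k.+1 * - (lam ^+ (p.-1 - k.+1) + y * w) =
          - (lam ^+ (k.+1 + (p.-1 - k.+1)) + lam * y * (lam ^+ k * w)).
  by rewrite exprD !exprS; ring.
by rewrite -pw subnKC // E; ring.
Qed.

(** Both x and its conjugate reduce to [P.[1]] modulo [lam], so p divides the square of this
    integer. Hence p divides [P.[1]], and [lam] divides p. *)
Lemma lam_dvd_norm x : cyclint x -> cyclint_dvd lam (x * x^*) -> cyclint_dvd lam x.
Proof.
move=> [P xP]; have [a aZ aE] := ev_augmentation P.
have [b bZ] := ev_augmentation (P \Po 'X^(p.-1)).
rewrite -[X in ev X (_ \Po _)](expr1 z) -conj_ev expr1 -xP.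
rewrite horner_comp hornerXn expr1n => bE lam_x.
rewrite -xP in aE; set s := P.[1] in aE bE.
have ps : (p %| s)%Z.
  suff: (p %| s * s)%Z.
    by rewrite !dvdzE abszM Euclid_dvdM //= orbb.
  apply: lam_dvd_int; rewrite intrM.
  have -> : s%:~R * s%:~R = x * x^* + lam * (- (a * x^* + s%:~R * b)) :> C.
    have -> : x^* = lam * b + s%:~R by rewrite -bE subrK.
    have -> : x = lam * a + s%:~R by rewrite -aE subrK.
    ring.
  apply: cyclint_dvdD => //; exists (- (a * x^* + s%:~R * b)) => //.
  apply/cyclintN/cyclintD; apply: cyclintM => //; last exact: cyclint_int.
  by apply: cyclint_conj; exists P.
have -> : x = lam * a + s%:~R by rewrite -aE subrK.
apply: cyclint_dvdD; first by exists a.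
have /dvdzP [c ->] := ps; rewrite intrM -pmulrn mulrC.
have [w wZ ->] := lam_pow_dvd_p.
exists (lam ^+ p.-2 * w * c%:~R).
  apply: cyclintM (cyclint_int c); apply: cyclintM wZ.
  exact/cyclintX/cyclint_lam.
by rewrite !mulrA -exprS prednK // -ltnS prednK.
Qed.

Lemma lam_pow_dvd_norm k x : cyclint x ->
  cyclint_dvd (lam ^+ k ^+ 2) (x * x^*) -> cyclint_dvd (lam ^+ k) x.
Proof.
have lam_conj : lam^* = - z^* * lam.
  rewrite rmorphB rmorph1 mulrBr mulr1 mulNr.
  have -> : z^* * z = 1.
    by have := conj_prim_root 1; rewrite expr1 => ->;
       rewrite -exprSr prednK // (prim_expr_order z_prim).
  by rewrite opprK addrC.
elim: k x => [|k IH] x xZ; first by exists x; rewrite ?mul1r.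
move=> [w wZ xw].
have [|y yZ xy] := lam_dvd_norm xZ.
  exists (lam ^+ k * lam ^+ k.+1 * w); last by rewrite xw !exprS; ring.
  by apply: cyclintM wZ; apply: cyclintM; apply/cyclintX/cyclint_lam.
suff [t tZ yt] : cyclint_dvd (lam ^+ k) y.
  by exists t; rewrite // xy yt exprS mulrA.
(* With x = [lam * y], the norm of x is [- z^* * lam ^+ 2] times that of y; the factor [- z] inverts
   the unit [- z^*]. *)
apply: IH => //; exists (- z * w).
  by apply: cyclintM wZ; apply/cyclintN/cyclint_root.
apply: (mulfI lam_neq0); apply: (mulfI lam_neq0).
have -> : lam * (lam * (lam ^+ k ^+ 2 * (- z * w))) =
          - z * (lam ^+ k.+1 ^+ 2 * w) by rewrite !exprS; ring.
rewrite -xw xy rmorphM /= lam_conj.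
have zz : z * z^* = 1.
  by have := conj_prim_root 1; rewrite expr1 => ->;
     rewrite -exprS prednK // (prim_expr_order z_prim).
transitivity ((z * z^*) * (lam * (lam * (y * y^*)))); first by rewrite zz mul1r.
by ring.
Qed.

Lemma cyclint_dvdX d x k : cyclint_dvd d x -> cyclint_dvd (d ^+ k) (x ^+ k).
Proof. by move=> [a aZ ->]; exists (a ^+ k); [apply: cyclintX | rewrite exprMn]. Qed.

(* z - 1 generates the only prime above p, and it is fixed by conjugation up to
   a unit, so x and x^* have the same valuation. *)
Lemma ppow_dvd_of_norm m x : cyclint x -> `|x| = p%:R ^+ m ->
  cyclint_dvd (p%:R ^+ m) x.
Proof.
move=> xZ nx; have [|y yZ ->] := lam_pow_dvd_norm (k := (p.-1 * m)%N) xZ.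
  by rewrite -normCK nx exprM; do 2!apply: cyclint_dvdX; apply: lam_pow_dvd_p.
rewrite exprM; apply: cyclint_dvdMr yZ.
exact/cyclint_dvdX/p_dvd_lam_pow.
Qed.
End CyclotomicIntegers.

(** * Cyclotomic integers of absolute value a power of p *)

Section CyclotomicUnits.
Variables (C : numClosedFieldType) (p : nat) (z : C).
Hypotheses (p_prime : prime p) (z_prim : p.-primitive_root z).

Local Notation ev x P := (map_poly (intr : int -> C) P).[x].

Let p_gt0 : (0 < p)%N := prime_gt0 p_prime.

(** After expanding the squares, the terms with i != j sum over k to zero, being powers of a
    nontrivial p-th root of unity. *)
Lemma parseval (c : 'I_p -> int) :
  \sum_(k < p) `|\sum_(i < p) (c i)%:~R * z ^+ (k * i)| ^+ 2 =
  (p%:R * \sum_(i < p) c i ^+ 2)%:~R.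
Proof.
have zX k : z ^+ k != 0.
  apply/expf_neq0/eqP => z0; have := prim_expr_order z_prim.
  by rewrite z0 expr0n gtn_eqF // => /eqP; rewrite eq_sym oner_eq0.
have zV k : (z ^+ k)^* = (z ^+ k)^-1.
  have zp1 : (z ^+ k) ^+ p = 1.
    by rewrite exprAC (prim_expr_order z_prim) expr1n.
  by apply: (mulfI (zX k)); rewrite (conj_prim_root p_prime z_prim) mulfV // -exprS
    prednK.
under eq_bigr => k _ do rewrite normCK rmorph_sum /= big_distrlr /=.
rewrite exchange_big /= mulr_sumr rmorph_sum /=; apply: eq_bigr => i _.
rewrite exchange_big /= (bigD1 i) //= [X in _ + X]big1 ?addr0 => [|j ji].
  rewrite (eq_bigr (fun=> (c i ^+ 2)%:~R)) => [|k _].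
    by rewrite sumr_const card_ord natz intrM -pmulrn mulr_natl.
  rewrite rmorphM /= rmorph_int zV mulrACA mulfV // mulr1.
  by rewrite expr2 intrM.
under eq_bigr => k _.
  rewrite rmorphM /= rmorph_int zV mulrACA ![(k * _)%N]mulnC !exprM -expr_div_n.
  over.
rewrite /= -mulr_sumr sum_unity_root ?mulr0 //.
  by rewrite expr_div_n !(exprAC _ _ p) (prim_expr_order z_prim) !expr1n divr1.
apply: contraNneq ji => /(canRL (divfK (zX j))); rewrite mul1r => /eqP.
by rewrite (eq_prim_root_expr z_prim) !modn_small // eq_sym.
Qed.

Lemma sum_sqr_eq1 (c : 'I_p -> int) : \sum_i c i ^+ 2 = 1 ->
  exists j, exists b : bool, forall i, c i = (-1) ^+ b * (i == j)%:R.
Proof.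
move=> c1; have [j cj] : exists j, c j != 0.
  apply/existsP; apply: contraT; rewrite negb_exists => /forallP c0.
  by move: c1; rewrite big1 // => i _; have := c0 i; rewrite negbK => /eqP ->.
have sq_ge0 i : 0 <= c i ^+ 2 by rewrite sqr_ge0.
have cj1 : 1 <= c j ^+ 2 by rewrite -gtz0_ge1 exprn_even_gt0.
move: c1; rewrite (bigD1 j) //= => c1.
have S0 : \sum_(i < p | i != j) c i ^+ 2 = 0.
  have : 0 <= \sum_(i < p | i != j) c i ^+ 2 by apply: sumr_ge0.
  by move: c1 cj1; move: (c j ^+ 2) (\sum_(i < p | i != j) _) => a b; lia.
have c0 i : i != j -> c i = 0.
  move=> ij; apply/eqP; rewrite -sqrf_eq0; apply/eqP.
  by apply: (psumr_eq0P _ S0).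
have : c j ^+ 2 = 1 by rewrite S0 addr0 in c1.
move/eqP; rewrite sqrf_eq1 => cj_eq.
exists j, (c j == -1) => i.
have [->|/c0 ->] := eqVneq i j; last by rewrite mulr0.
by case/orP: cj_eq => /eqP ->.
Qed.

(* By Parseval, p * (\sum c_i^2) = (\sum c_i)^2 + p - 1, so \sum c_i = +-1 mod p.
   Adding a constant to all c_i, which does not change the sums for k prime to
   p, makes \sum c_i = +-1; then \sum c_i^2 = 1 and a single c_i is nonzero. *)
Lemma cyclotomic_unit (c : 'I_p -> int) :
  (forall k, ~~ (p %| k)%N -> `|\sum_(i < p) (c i)%:~R * z ^+ (k * i)| = 1) ->
  exists j : 'I_p, exists b : bool,
    \sum_(i < p) (c i)%:~R * z ^+ i = (-1) ^+ b * z ^+ j.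
Proof.
move=> c_norm; set s := \sum_i c i.
have Ppars (d : 'I_p -> int) :
    (forall k, ~~ (p %| k)%N -> `|\sum_(i < p) (d i)%:~R * z ^+ (k * i)| = 1) ->
    p%:R * \sum_(i < p) d i ^+ 2 = (\sum_i d i) ^+ 2 + p%:R - 1.
  move=> d_norm; apply: (@intr_inj C); rewrite -parseval.
  rewrite (bigD1 (Ordinal p_gt0)) //=.
  rewrite (eq_bigr (fun i => (d i)%:~R)) => [|i _]; last by rewrite mul0n expr0 mulr1.
  rewrite -rmorph_sum /= -addrA [LHS]addrC intrD [RHS]addrC; congr (_ + _).
    rewrite (eq_bigr (fun=> 1)) => [|k k0].
      rewrite sumr_const cardC1 card_ord -subn1 natrB //.
      by rewrite intrB natz.
    rewrite d_norm ?expr1n //; rewrite gtnNdvd //.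
    by rewrite lt0n; apply: contraNneq k0 => k0; apply/eqP/val_inj.
  by rewrite normCK rmorph_int -expr2 rmorphXn.
have := Ppars c c_norm; rewrite -/s => sE.
have [t [e [e1 st]]] : exists t, exists e, e ^+ 2 = 1 /\ s = e + p%:R * t.
  have : (p %| (s - 1) * (s + 1))%Z.
    apply/dvdzP; exists (\sum_i c i ^+ 2 - 1).
    by rewrite [RHS]mulrBl mul1r [in RHS]mulrC; move: sE; rewrite natz => ->; ring.
  rewrite dvdzE abszM Euclid_dvdM // => /orP[] /dvdzP [t tE].
    by exists t, 1; split; rewrite // natz mulrC -tE; ring.
  by exists t, (-1); split; rewrite // natz mulrC -tE; ring.
have shift k : ~~ (p %| k)%N ->
    \sum_(i < p) (c i - t)%:~R * z ^+ (k * i) = \sum_(i < p) (c i)%:~R * z ^+ (k * i).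
  move=> pk; under eq_bigr => i _ do rewrite intrB mulrBl.
  rewrite sumrB -mulr_sumr; under [X in _ - _ * X]eq_bigr => i _ do rewrite exprM.
  by rewrite (sum_prim_root z_prim pk) mulr0 subr0.
have := Ppars (fun i => c i - t).
have -> : \sum_i (c i - t) = e.
  by rewrite sumrB -/s sumr_const card_ord -[t *+ p]mulr_natl st addrK.
rewrite e1 => P1.
have [|j [b cE]] := @sum_sqr_eq1 (fun i => c i - t).
  have p0 : p%:R != 0 :> int by rewrite pnatr_eq0 -lt0n.
  apply: (mulfI p0); rewrite P1; first by ring.
  by move=> k pk; rewrite shift ?c_norm.
exists j, b; have := shift 1%N.
rewrite (eq_bigr (fun i : 'I_p => (c i - t)%:~R * z ^+ i)) => [|i _]; last by rewrite mul1n.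
rewrite [in X in _ -> X](eq_bigr (fun i : 'I_p => (c i)%:~R * z ^+ (1 * i))) => [|i _];
  last by rewrite mul1n.
move=> <-; last by rewrite dvdn1 neq_ltn prime_gt1 ?orbT.
rewrite (bigD1 j) //= cE eqxx mulr1 rmorph_sign big1 ?addr0 // => i ij.
by rewrite cE (negPf ij) mulr0 mul0r.
Qed.

(** The polynomial ['X^p - 1] vanishes at every [z ^+ k], so the remainder modulo it gives
    coefficients common to all conjugates. *)
Lemma ev_coefs (P : {poly int}) : exists c : 'I_p -> int,
  forall k, ev (z ^+ k) P = \sum_(i < p) (c i)%:~R * z ^+ (k * i).
Proof.
pose D : {poly int} := 'X^p - 1.
have monD : D \is monic by apply: monicXnsubC.
have sD : size D = p.+1 by apply: size_XnsubC.
exists (fun i => (Pdiv.Field.modp P D)`_i) => k.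
rewrite [in LHS](Pdiv.IdomainMonic.divp_eq monD P) rmorphD rmorphM hornerD hornerM.
have -> : ev (z ^+ k) D = 0.
  rewrite rmorphB /= map_polyXn rmorph1 !hornerE exprAC (prim_expr_order z_prim).
  by rewrite expr1n subrr.
rewrite mulr0 add0r (@horner_coef_wide _ p).
  by apply: eq_bigr => i _; rewrite coef_map exprM.
rewrite (leq_trans (size_poly _ _)) // -ltnS -sD.
by apply: ltn_modpN0; apply: monic_neq0.
Qed.

Lemma cyclint_norm_ppow (x : C) m : cyclint z x -> `|x| = p%:R ^+ m ->
  exists j : 'I_p, exists b : bool, x = (-1) ^+ b * (p%:R ^+ m * z ^+ j).
Proof.
move=> xZ nx; have [y [P yP] xy] := ppow_dvd_of_norm p_prime z_prim xZ nx.
have pm0 : p%:R ^+ m != 0 :> C by rewrite expf_neq0 // pnatr_eq0 -lt0n.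
have ny : `|y| = 1.
  apply: (mulfI pm0); rewrite mulr1 -[RHS]nx xy normrM; congr (_ * _).
  by rewrite ger0_norm // exprn_ge0 // ler0n.
have [c cP] := ev_coefs P.
have [|j [b jb]] := @cyclotomic_unit c.
  (* That y has absolute value 1 means that the polynomial [P * (P \Po 'X^(p.-1)) - 1] vanishes at
     z; Galois conjugation transports this to [z ^+ k]. *)
  move=> k pk; rewrite -cP; apply: (pexpIrn (n := 2)); rewrite ?nnegrE //.
  rewrite expr1n normCK (conj_ev p_prime z_prim).
  apply/eqP; rewrite -subr_eq0 -hornerM -rmorphM.
  have -> : 1 = ev (z ^+ k) 1 by rewrite rmorph1 hornerC.
  rewrite -hornerN -hornerD -rmorphB; apply/eqP.
  apply: (prim_root_conjugate p_prime z_prim) pk.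
  rewrite rmorphB rmorphM /= rmorph1 !hornerE -[X in ev X (_ \Po _)](expr1 z).
  by rewrite -(conj_ev p_prime z_prim) expr1 -yP -normCK ny expr1n subrr.
exists j, b; rewrite xy yP -[X in ev X _](expr1 z) cP.
under eq_bigr do rewrite mul1n.
by rewrite jb mulrCA.
Qed.
End CyclotomicUnits.

(** * Additive characters of the prime field *)

Section Characters.
Variables (C : numClosedFieldType) (p : nat) (z : C).
Hypotheses (p_prime : prime p) (z_prim : p.-primitive_root z).

Definition add_char (k : 'F_p) : C := z ^+ k.

Local Notation chi := add_char.

Lemma Fp_ltn (k : 'F_p) : (k < p)%N.
Proof. by rewrite -[X in (_ < X)%N](Fp_cast p_prime) ltn_ord. Qed.

Lemma chi_nat (k : nat) : chi k%:R = z ^+ k.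
Proof.
by rewrite /add_char val_Fp_nat // (prim_expr_mod z_prim).
Qed.

Lemma chi0 : chi 0 = 1.
Proof. by rewrite -[0]/(0%:R) chi_nat. Qed.

Lemma chiD a b : chi (a + b) = chi a * chi b.
Proof. by rewrite -(natr_Zp a) -(natr_Zp b) -natrD !chi_nat exprD. Qed.

Lemma chiM_nat (k : nat) a : chi (k%:R * a) = chi a ^+ k.
Proof. by rewrite -[a in LHS]natr_Zp -natrM chi_nat mulnC exprM. Qed.

Lemma chi_inj : injective chi.
Proof.
move=> a b /eqP; rewrite (eq_prim_root_expr z_prim) !modn_small ?Fp_ltn //.
by move/eqP/val_inj.
Qed.

Lemma chi_neq0 a : chi a != 0.
Proof.
apply/negP => /eqP a0; have := chiD a (- a).
by rewrite subrr chi0 a0 mul0r => /eqP; rewrite oner_eq0.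
Qed.

Lemma cyclint_chi a : cyclint z (chi a).
Proof. exact/cyclintX/cyclint_root. Qed.

(** The hypothesis is an integer relation between powers of z, which is evaluated at the conjugate
    [z ^+ t]; the integer N is left fixed. *)
Lemma chi_conjugate (T : finType) (A : {pred T}) (g : T -> 'F_p) (N : int) k t :
  t != 0 -> \sum_(x in A) chi (g x) = N%:~R * chi k ->
  \sum_(x in A) chi (t * g x) = N%:~R * chi (t * k).
Proof.
move=> t0 E; pose P : {poly int} := \sum_(x in A) 'X^(g x) - N *: 'X^k.
have evP s : (map_poly (intr : int -> C) P).[z ^+ s] =
    \sum_(x in A) chi (s%:R * g x) - N%:~R * chi (s%:R * k).
  rewrite rmorphB rmorph_sum hornerD hornerN horner_sum /= linearZ /= map_polyXn.
  rewrite hornerZ hornerXn chiM_nat -!exprM mulnC; congr (_ - _).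
  by apply: eq_bigr => x _; rewrite map_polyXn hornerXn chiM_nat -!exprM mulnC.
have P0 : (map_poly (intr : int -> C) P).[z] = 0.
  rewrite -[X in _.[X]](expr1 z) evP; under eq_bigr do rewrite mul1r.
  by rewrite mul1r E subrr.
have nt : ~~ (p %| t)%N.
  by rewrite gtnNdvd ?Fp_ltn // lt0n; apply: contraNneq t0 => t0; apply/eqP/val_inj.
have := prim_root_conjugate p_prime z_prim P0 nt.
by rewrite evP natr_Zp => /eqP; rewrite subr_eq0 => /eqP.
Qed.

(** For odd p and distinct i, j there is a third exponent l. All coefficients of an integer relation
    between the p-th roots of unity being equal, comparing those at i and l makes N even. *)
Lemma chi_parity (N : int) (b : bool) (i j : 'F_p) (y : C) : odd p ->
  ~~ (2 %| N)%Z -> cyclint z y ->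
  N%:~R * (chi i + (-1) ^+ b * chi j) = 2 * y -> i = j.
Proof.
move=> p_odd Nodd [P yP] E; apply: contraTeq Nodd => ij; rewrite negbK.
have [c cP] := ev_coefs p_prime z_prim P.
have {}yP : y = \sum_(l < p) (c l)%:~R * z ^+ l.
  rewrite yP -[X in _.[X]](expr1 z) cP; by under eq_bigr do rewrite mul1n.
pose i' := Ordinal (Fp_ltn i); pose j' := Ordinal (Fp_ltn j).
have ij' : i' != j' by apply: contraNneq ij => /(congr1 val) /= /val_inj ->.
have [l li lj] : exists2 l : 'I_p, l != i' & l != j'.
  have : (0 < #|~: [set i'; j']|)%N.
    rewrite cardsCs setCK cards2 ij' card_ord subn_gt0.
    by case: (p) p_prime p_odd => [|[|[|]]].
  by case/card_gt0P => l; rewrite !inE negb_or => /andP[]; exists l.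
pose d (l : 'I_p) : int := N * ((l == i')%:R + (-1) ^+ b * (l == j')%:R) - 2 * c l.
have single (k : 'I_p) : \sum_(l < p) (l == k)%:R * z ^+ l = z ^+ k.
  rewrite (bigD1 k) //= eqxx mul1r big1 ?addr0 // => m /negPf ->.
  by rewrite mul0r.
have := prim_root_relation p_prime z_prim (c := d).
have -> : \sum_(l < p) (d l)%:~R * z ^+ l = 0.
  rewrite -[RHS](subrr (2 * y)) -[in X in _ = X - _]E yP /add_char.
  rewrite -[z ^+ i](single i') -[z ^+ j](single j').
  rewrite !mulr_sumr -big_split /= mulr_sumr -sumrB; apply: eq_bigr => m _.
  rewrite /d intrB !intrM intrD intrM rmorph_sign -!pmulrn.
  by case: (m == i'); case: (m == j'); rewrite /=; ring.
move=> /(_ erefl) /(_ i' l); rewrite /d eqxx (negPf ij') (negPf li) (negPf lj).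
rewrite mulr0 !addr0 !mulr0 mulr1 sub0r => EN.
by apply/dvdzP; exists (c i' - c l); lia.
Qed.
End Characters.

(** * Fourier transform *)

Section DotProduct.
Variables (p n : nat).
Implicit Types x y : 'rV['F_p]_n.

Lemma dotC x y : dot x y = dot y x.
Proof. by apply: eq_bigr => i _; rewrite mulrC. Qed.

Lemma dotDr x y1 y2 : dot x (y1 + y2) = dot x y1 + dot x y2.
Proof. by rewrite -big_split; apply: eq_bigr => i _; rewrite mxE mulrDr. Qed.

Lemma dotZr x c y : dot x (c *: y) = c * dot x y.
Proof. by rewrite mulr_sumr; apply: eq_bigr => i _; rewrite mxE mulrCA. Qed.

Lemma dotDl x1 x2 y : dot (x1 + x2) y = dot x1 y + dot x2 y.
Proof. by rewrite ![dot _ y]dotC dotDr. Qed.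

Lemma dotZl c x y : dot (c *: x) y = c * dot x y.
Proof. by rewrite ![dot _ y]dotC dotZr. Qed.

Lemma dot0r x : dot x 0 = 0.
Proof. by rewrite -(scale0r 0) dotZr mul0r. Qed.

Lemma dot0l x : dot 0 x = 0.
Proof. by rewrite dotC dot0r. Qed.

Lemma dotNr x y : dot x (- y) = - dot x y.
Proof. by rewrite -scaleN1r dotZr mulN1r. Qed.

Lemma dotNl x y : dot (- x) y = - dot x y.
Proof. by rewrite dotC dotNr dotC. Qed.

Lemma orthP (A : {set 'rV['F_p]_n}) y :
  reflect (forall x, x \in A -> dot x y = 0) (y \in orth A).
Proof.
by rewrite inE; apply: (iffP forall_inP) => h x /h /eqP.
Qed.

Lemma orth0 (A : {set 'rV['F_p]_n}) : 0 \in orth A.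
Proof. by apply/orthP => x _; rewrite dot0r. Qed.

Lemma orth_setT (y : 'rV['F_p]_n) : (y \in orth setT) = (y == 0).
Proof.
apply/orthP/eqP => [h|-> x _]; last by rewrite dot0r.
apply/rowP => i; have := h (delta_mx 0 i) (in_setT _).
rewrite /dot (bigD1 i) //= !mxE !eqxx mul1r big1 ?addr0 // => j ji.
by rewrite mxE (negPf ji) andbF mul0r.
Qed.
End DotProduct.

Definition is_subspace (p n : nat) (A : {set 'rV['F_p]_n}) :=
  exists W : {vspace 'rV['F_p]_n}, A = [set x | x \in W].

Section FourierTransform.
Variables (C : numClosedFieldType) (p : nat) (z : C) (n : nat).
Hypotheses (p_prime : prime p) (z_prim : p.-primitive_root z).
Local Notation E := 'rV['F_p]_n.
Local Notation chi := (@add_char C p z).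
Implicit Types (x : E) (A B : {set E}) (f g : E -> 'F_p).

Lemma card_space : #|E| = (p ^ n)%N.
Proof. by rewrite card_mx card_Fp // mul1n. Qed.

Lemma subspace_setT : is_subspace [set: E].
Proof. by exists fullv; apply/setP => x; rewrite !inE memvf. Qed.

(** * Character sums over subspaces *)

Section Subspaces.
Variable A : {set E}.
Hypothesis subA : is_subspace A.

Lemma subspace0 : 0 \in A.
Proof. by have [W ->] := subA; rewrite inE mem0v. Qed.

Lemma subspaceD x y : x \in A -> y \in A -> x + y \in A.
Proof. by have [W ->] := subA; rewrite !inE; apply: memvD. Qed.

Lemma subspaceZ c x : x \in A -> c *: x \in A.
Proof. by have [W ->] := subA; rewrite !inE; apply: memvZ. Qed.

Lemma subspaceZ_eq c x : c != 0 -> (c *: x \in A) = (x \in A).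
Proof.
move=> c0; apply/idP/idP; last exact: subspaceZ.
by move/(subspaceZ c^-1); rewrite scalerA mulVf // scale1r.
Qed.

Lemma subspaceN x : (- x \in A) = (x \in A).
Proof. by rewrite -scaleN1r subspaceZ_eq // oppr_eq0 oner_eq0. Qed.

Lemma subspace_addl x y : x \in A -> (x + y \in A) = (y \in A).
Proof.
move=> xA; apply/idP/idP; last exact: subspaceD.
by move=> xyA; rewrite -(addKr x y) subspaceD ?subspaceN.
Qed.

(** If [dot b x != 0] for some b in A, translation by b multiplies the sum by a factor other than
    1. *)
Lemma sum_chi_subspace x :
  \sum_(a in A) chi (dot a x) = #|A|%:R * (x \in orth A)%:R.
Proof.
have [xA|] := boolP (x \in orth A).
  rewrite mulr1 (eq_bigr (fun=> 1)) ?sumr_const // => a aA.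
  by rewrite (orthP _ _ xA) // chi0.
rewrite inE negb_forall_in mulr0 => /exists_inP [b bA bx0].
have cb1 : chi (dot b x) - 1 != 0.
  rewrite subr_eq0 -(chi0 p_prime z_prim).
  by apply: contra bx0 => /eqP /(chi_inj p_prime z_prim) ->.
apply: (mulfI cb1); rewrite mulr0 mulrBl mul1r.
rewrite [X in _ - X](reindex_inj (addrI b)) /=.
rewrite [X in _ - X](eq_bigl (fun a => a \in A)) => [|a]; last by rewrite /= subspace_addl.
apply/eqP; rewrite subr_eq0 mulr_sumr; apply/eqP/eq_bigr => a _.
by rewrite dotDl chiD.
Qed.
End Subspaces.

Lemma sum_chi_full (x : E) : \sum_a chi (dot a x) = (p ^ n)%:R * (x == 0)%:R.
Proof.
have := sum_chi_subspace subspace_setT x; rewrite orth_setT cardsT card_space => <-.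
by apply: eq_bigl => a; rewrite inE.
Qed.

(** The double sum of [chi (dot a x)] over a in A and all x is evaluated in both orders. *)
Lemma card_orth A : is_subspace A -> (#|A| * #|orth A|)%N = (p ^ n)%N.
Proof.
move=> subA; apply/eqP; rewrite -(eqr_nat C) natrM; apply/eqP.
transitivity (\sum_(x : E) \sum_(a in A) chi (dot a x)).
  under eq_bigr do rewrite (sum_chi_subspace subA).
  rewrite -mulr_sumr; congr (_ * _); rewrite -sum1_card natr_sum big_mkcond /=.
  by apply: eq_bigr => x _; case: ifP.
rewrite exchange_big /=; under eq_bigr => a _.
  under eq_bigr do rewrite dotC.
  rewrite sum_chi_full.
  over.
rewrite -mulr_sumr (bigD1 0) ?subspace0 //= eqxx big1 ?addr0 ?mulr1 // => a.
by case/andP=> _ /negPf ->.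
Qed.

Lemma sum_chi_Fp : \sum_(t : 'F_p) chi t = 0.
Proof.
have z1 : z - 1 != 0 by rewrite subr_eq0 (prim_root_neq1 p_prime z_prim).
rewrite /add_char -(big_mkord predT (fun k => z ^+ k)) Fp_cast // big_mkord.
by apply: (mulfI z1); rewrite mulr0 -subrX1 (prim_expr_order z_prim) subrr.
Qed.

Definition fourier_transform (F : E -> C) (x : E) : C := \sum_a F a * chi (dot a x).

Local Notation fourier := fourier_transform.

(** Poisson summation: times [#|A|], the indicator of [orth A] is a character sum over A, and
    exchanging the sums leaves a delta function at [- x]. *)
Lemma fourier_orth A x : is_subspace A ->
  fourier (fun a => (a \in orth A)%:R) x = #|orth A|%:R * (x \in A)%:R.
Proof.
move=> subA; have A0 : #|A|%:R != 0 :> C.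
  by rewrite pnatr_eq0 -lt0n; apply/card_gt0P; exists 0; apply: subspace0.
apply: (mulfI A0); rewrite mulrA -natrM (card_orth subA) /fourier_transform mulr_sumr.
under eq_bigr => a _.
  rewrite mulrA -(sum_chi_subspace subA) mulr_suml.
  under eq_bigr do rewrite dotC -chiD // -dotDr addrC.
  over.
rewrite exchange_big /=; under eq_bigr do rewrite sum_chi_full.
rewrite -mulr_sumr; congr (_ * _); rewrite -(subspaceN subA).
have [xA|xA] := boolP (- x \in A).
  rewrite (bigD1 (- x)) //= subrr eqxx big1 ?addr0 // => a /andP[_ /negPf ax].
  by rewrite addrC addr_eq0 ax.
rewrite big1 // => a aA; rewrite addrC addr_eq0; case: eqP => // ax.
by rewrite -ax aA in xA.
Qed.

(** The condition [g a == j] is detected by averaging [chi (t * (g a - j))] over t, which leads to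
    the sums in [fourier_dual]. *)
Lemma fourier_level (A : {set E}) (g : E -> 'F_p) j x :
  p%:R * fourier (fun a => ((a \in A) && (g a == j))%:R) x =
  \sum_t chi (- (t * j)) * \sum_(a in A) chi (t * g a + dot a x).
Proof.
rewrite /fourier_transform mulr_sumr; under [RHS]eq_bigr do rewrite mulr_sumr.
rewrite [RHS]exchange_big /= [RHS]big_mkcond /=; apply: eq_bigr => a _.
case: (a \in A) => /=; last by rewrite mul0r mulr0.
have [<-|gj] := eqVneq (g a) j.
  rewrite (eq_bigr (fun=> chi (dot a x))) => [|t _]; last first.
    by rewrite -chiD // addKr.
  by rewrite sumr_const card_Fp // mul1r mulr_natl.
rewrite mul0r mulr0 (eq_bigr (fun t => chi (dot a x) * chi (t * (g a - j)))) => [|t _].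
  rewrite -mulr_sumr (reindex_inj (mulIf (_ : (g a - j)^-1 != 0))) /=; last first.
    by rewrite invr_eq0 subr_eq0.
  under eq_bigr do rewrite mulfVK ?subr_eq0 //.
  rewrite sum_chi_Fp mulr0 //.
by rewrite -!chiD //; congr (add_char _ _); ring.
Qed.

End FourierTransform.

(** * Dual partitions *)

Section Duality.
Variables (C : numClosedFieldType) (p : nat) (z : C) (n : nat).
Hypotheses (p_prime : prime p) (z_prim : p.-primitive_root z).
Local Notation E := 'rV['F_p]_n.
Local Notation chi := (@add_char C p z).
Local Notation fourier := (@fourier_transform C p z n).

(* With B = B_+(f^* ) and O = B_+(f)^\bot, the fibres over inl true, inl false,
   inr (false, j) and inr (true, j) are {0}, O \ 0, c_j(f) \ O and d_j(f). *)
Definition class_label (B O : {set E}) (f : E -> 'F_p) (x : E) : bool + bool * 'F_p :=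
  if x == 0 then inl true
  else if x \in O then inl false
  else inr (x \notin B, f x).

Definition class_function (T : Type) (B O : {set E}) (f : E -> 'F_p) (G : E -> T) :=
  forall x y, class_label B O f x = class_label B O f y -> G x = G y.

(** The functions [phi] are left free: what matters is that each sum depends on x only through [f x]
    and membership in B. *)
Definition fourier_dual (A : {set E}) (g : E -> 'F_p) (B : {set E}) (f : E -> 'F_p) :=
  forall t, t != 0 ->
    (exists phi : 'F_p -> C, forall x,
       \sum_(a in A) chi (t * g a + dot a x) = phi (f x) * (x \in B)%:R) /\
    (exists phi : 'F_p -> C, forall x,
       \sum_(a in ~: A) chi (t * g a + dot a x) = phi (f x) * (x \in ~: B)%:R).

Lemma eq_fourier F G : F =1 G -> fourier F =1 fourier G.
Proof. by move=> FG x; apply: eq_bigr => a _; rewrite FG. Qed.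

Lemma fourierB F G x :
  fourier (fun a => F a - G a) x = fourier F x - fourier G x.
Proof. by rewrite /fourier_transform -sumrB; apply: eq_bigr => a _; rewrite mulrBl. Qed.

Lemma fourierZ c F x : fourier (fun a => c * F a) x = c * fourier F x.
Proof. by rewrite /fourier_transform mulr_sumr; apply: eq_bigr => a _; rewrite mulrA. Qed.

Lemma fourier_delta0 x : fourier (fun a => (a == 0)%:R) x = 1.
Proof.
rewrite /fourier_transform (bigD1 0) //= eqxx dot0l (chi0 p_prime z_prim) mulr1.
by rewrite big1 ?addr0 // => a /negPf ->; rewrite mul0r.
Qed.

(** On [orth A] the label forgets B and f, but there x lies in B and f vanishes, so nothing is
    lost. *)
Lemma class_labelP (A B : {set E}) (f : E -> 'F_p) x y :
  orth A \subset B -> {in orth A, forall u, f u = 0} ->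
  class_label B (orth A) f x = class_label B (orth A) f y ->
  [/\ (x == 0) = (y == 0), (x \in orth A) = (y \in orth A),
      (x \in B) = (y \in B) & f x = f y].
Proof.
move=> /subsetP AB f0; rewrite /class_label.
have [->|x0] := eqVneq x 0; have [->|y0] := eqVneq y 0 => //.
- by case: ifP.
- by case: ifP.
case: ifP => xA; case: ifP => yA //; first by rewrite !AB // !f0.
by case=> /(congr1 negb); rewrite !negbK.
Qed.

(** * Fourier transforms of functions constant on classes *)

Section Transform.
Variables (A B : {set E}) (f g : E -> 'F_p).
Hypotheses (subA : is_subspace A) (subB : is_subspace B).
Hypotheses (dualAB : fourier_dual A g B f).
Hypotheses (orthAB : orth A \subset B) (f0 : {in orth A, forall u, f u = 0}).
Hypotheses (orthBA : orth B \subset A) (g0 : {in orth B, forall u, g u = 0}).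

Local Notation classf G := (class_function B (orth A) f G).

Let pC_neq0 : p%:R != 0 :> C.
Proof. by rewrite pnatr_eq0 -lt0n prime_gt0. Qed.

(** Terms with t != 0 are governed by [fourier_dual]. The term t = 0 is a character sum over A or
    its complement, which sees [orth A] and 0: this is why these are separated from the level
    sets. *)
Lemma fourier_level_class (b : bool) j :
  classf (fourier (fun a => ((a \in (if b then ~: A else A)) && (g a == j))%:R)).
Proof.
move=> x y /(class_labelP orthAB f0) [xy0 xyA xyB fxy].
apply: (mulfI pC_neq0); rewrite !fourier_level //; apply: eq_bigr => t _.
congr (_ * _); have [->|t0] := eqVneq t 0; last first.
  case: b; have [[phi phiE] [psi psiE]] := dualAB t0.
    by rewrite !psiE !inE fxy xyB.
  by rewrite !phiE fxy xyB.
have sumA u : \sum_(a in A) chi (0 * g a + dot a u) = #|A|%:R * (u \in orth A)%:R.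
  by rewrite -(sum_chi_subspace p_prime z_prim subA); under eq_bigr do rewrite mul0r add0r.
case: b; last by rewrite !sumA xyA.
have sumCA u : \sum_(a in ~: A) chi (0 * g a + dot a u) =
    (p ^ n)%:R * (u == 0)%:R - #|A|%:R * (u \in orth A)%:R.
  rewrite -(sum_chi_full p_prime z_prim) -sumA [X in _ = X - _](bigID (mem A)) /=.
  under [X in _ = _ - X]eq_bigr do rewrite mul0r add0r.
  rewrite [X in X - _]addrC addrK; apply: eq_big => a; first by rewrite inE.
  by rewrite mul0r add0r.
by rewrite !sumCA xy0 xyA.
Qed.

Lemma fourier_label_class L :
  classf (fourier (fun a => (class_label A (orth B) g a == L)%:R)).
Proof.
have oB0 := orth0 B.
move=> x y xy; have [_ _ xyB _] := class_labelP orthAB f0 xy.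
have orthxy : fourier (fun a => (a \in orth B)%:R) x = fourier (fun a => (a \in orth B)%:R) y.
  by rewrite !fourier_orth // xyB.
case: L => [[]|[[] j]].
- have E0 : (fun a => (class_label A (orth B) g a == inl true)%:R) =1
      (fun a => (a == 0)%:R : C).
    by move=> a; rewrite /class_label; case: (a == 0) => //; case: ifP.
  by rewrite !(eq_fourier E0) !fourier_delta0.
- have E0 : (fun a => (class_label A (orth B) g a == inl false)%:R) =1
      (fun a => (a \in orth B)%:R - (a == 0)%:R : C).
    move=> a; rewrite /class_label; have [->|_] := eqVneq a 0.
      by rewrite oB0 subrr.
    by case: ifP; rewrite subr0.
  by rewrite !(eq_fourier E0) !fourierB !fourier_delta0 orthxy.
- have E0 : (fun a => (class_label A (orth B) g a == inr (true, j))%:R) =1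
      (fun a => ((a \in ~: A) && (g a == j))%:R : C).
    move=> a; rewrite /class_label in_setC; have [->|_] := eqVneq a 0.
      by rewrite (subsetP orthBA).
    case: ifP => [aB|_]; first by rewrite (subsetP orthBA).
    by rewrite /eq_op /= /eq_op /= eqb_id.
  by rewrite !(eq_fourier E0); apply: (@fourier_level_class true).
(* Inside A, [orth B] lies in the level set of 0 and has its own labels, so it is removed exactly
   when j = 0. *)
- have E0 : (fun a => (class_label A (orth B) g a == inr (false, j))%:R) =1
      (fun a => ((a \in A) && (g a == j))%:R - (j == 0)%:R * (a \in orth B)%:R : C).
    move=> a; rewrite /class_label; have [->|_] := eqVneq a 0.
      by rewrite (subsetP orthBA) // g0 // oB0 mulr1 [0 == j]eq_sym subrr.
    case: ifP => [aB|_]; first by rewrite (subsetP orthBA) // g0 // mulr1 [0 == j]eq_sym subrr.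
    by rewrite mulr0 subr0 /eq_op /= /eq_op /= eqbF_neg negbK.
  rewrite !(eq_fourier E0) !fourierB !fourierZ orthxy; congr (_ - _).
  exact: (@fourier_level_class false).
Qed.

Lemma fourier_class F : class_function A (orth B) g F -> classf (fourier F).
Proof.
move=> FA.
(* [val L] is the value of F on the class L; the default 0 concerns empty classes, whose indicator
   is zero. *)
pose val L : C := if [pick a | class_label A (orth B) g a == L] is Some a then F a else 0.
have FE x : fourier F x =
    \sum_L val L * fourier (fun a => (class_label A (orth B) g a == L)%:R) x.
  rewrite /fourier_transform (partition_big (class_label A (orth B) g) predT) //=.
  apply: eq_bigr => L _; rewrite mulr_sumr [LHS]big_mkcond /=; apply: eq_bigr => a _.
  case: eqP => [aL|_]; last by rewrite mul0r mulr0.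
  rewrite mul1r /val; case: pickP => [b /eqP bL|/(_ a)]; last by rewrite aL eqxx.
  by congr (_ * _); apply: FA; rewrite aL bL.
by move=> x y xy; rewrite !FE; apply: eq_bigr => L _; rewrite (fourier_label_class L xy).
Qed.
End Transform.
End Duality.

(** * Translation schemes *)

Section Fibres.
Variables (X T : finType) (h : X -> T).
Hypothesis h_surj : forall t, exists x, h x = t.

Definition fibre t := [set x | h x == t].

Lemma fibre_inj : injective fibre.
Proof.
move=> s t st; have [x xs] := h_surj s.
have : x \in fibre t by rewrite -st inE xs.
by rewrite inE xs => /eqP.
Qed.

Lemma fibre_partition : partition [set fibre t | t : T] [set: X].
Proof.
apply/and3P; split.
- apply/eqP/setP => x; rewrite !inE; apply/bigcupP; exists (fibre (h x)).
    exact: imset_f.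
  by rewrite inE.
- apply/trivIsetP => _ _ /imsetP[s _ ->] /imsetP[t _ ->] st.
  rewrite -setI_eq0; apply/eqP/setP => x; rewrite !inE.
  apply/negP => /andP[/eqP xs /eqP xt]; move: st.
  by rewrite -xs -xt eqxx.
- apply/imsetP => -[t _ /setP]; have [x xt] := h_surj t.
  by move/(_ x); rewrite !inE xt eqxx.
Qed.
End Fibres.

(** A transposition moves [t0] to the front of the standard enumeration, as the numbering of a
    scheme has to begin with the class of 0. *)
Lemma enum_from (T : finType) (t0 : T) d : #|T| = d.+1 ->
  exists e : 'I_d.+1 -> T, bijective e /\ e ord0 = t0.
Proof.
move=> cT; pose e i := enum_val (cast_ord (esym cT) i).
have e_bij : bijective e.
  by exists (fun t => cast_ord cT (enum_rank t)) => i;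
     rewrite /e ?enum_valK ?cast_ordKV // cast_ordK enum_rankK.
exists (tperm t0 (e ord0) \o e); split; last by rewrite /= tpermR.
by apply: bij_comp e_bij; exists (tperm t0 (e ord0)); apply: tpermK.
Qed.

Lemma label_scheme (V : finZmodType) (T : finType) (cl : V -> T) d :
  #|T| = d.+1 -> (forall t, exists x, cl x = t) ->
  (forall x, cl x = cl 0 -> x = 0) -> (forall x, cl (- x) = cl x) ->
  (forall s t x y x' y', cl (x - y) = cl (x' - y') ->
     #|[set u | (cl (x - u) == s) && (cl (u - y) == t)]| =
     #|[set u | (cl (x' - u) == s) && (cl (u - y') == t)]|) ->
  induces_symmetric_scheme d [set fibre cl t | t : T].
Proof.
move=> cT cl_surj cl0 clN cl_num.
have [e [e_bij e0]] := enum_from (cl 0) cT.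
have e_inj := bij_inj e_bij.
pose h (ab : V * V) := cl (ab.1 - ab.2).
have h_surj t : exists ab, h ab = t.
  by have [x <-] := cl_surj t; exists (x, 0); rewrite /h /= subr0.
have RelE i : [set ab : V * V | ab.1 - ab.2 \in fibre cl (e i)] = fibre h (e i).
  by apply/setP => ab; rewrite !inE.
have e_im (U : finType) (F : T -> U) : [set F (e i) | i : 'I_d.+1] = [set F t | t : T].
  apply/setP => y; apply/imsetP/imsetP => -[i _ ->]; first by exists (e i).
  by have [e' _ e'K] := e_bij; exists (e' i); rewrite ?e'K.
have Rel_sym i : transpose_rel (fibre h (e i)) = fibre h (e i).
  by apply/setP => -[a b]; rewrite !inE /h /= -clN opprB.
exists (fun i => fibre cl (e i)); split.
- by move=> i j /(fibre_inj cl_surj)/e_inj.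
- by rewrite (e_im _ (fibre cl)).
- by apply/setP => x; rewrite !inE e0; apply/eqP/eqP => [/cl0|->].
split; last by move=> i; rewrite RelE Rel_sym.
split.
- by apply/card_gt0P; exists 0.
- split; first by move=> i j; rewrite !RelE => /(fibre_inj h_surj)/e_inj.
  rewrite (eq_imset _ RelE) (e_im _ (fibre h)).
  exact: fibre_partition.
- rewrite RelE; apply/setP => -[a b]; rewrite !inE /h /= e0.
  by apply/eqP/eqP => [/cl0/eqP|->]; rewrite ?subrr // subr_eq0 => /eqP.
- by move=> i; exists i; rewrite RelE Rel_sym.
move=> u v w; have [w0 hw0] := cl_surj (e w).
(* The count is made at the pair (w0, 0), which has label [e w]; by [cl_num] every pair with this
   label gives the same number. *)
exists #|[set x | (cl (w0 - x) == e u) && (cl (x - 0) == e v)]| => x y.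
rewrite RelE inE /h /= => /eqP xy; rewrite -(cl_num _ _ x y) ?subr0 ?hw0 //.
by apply: eq_card => a; rewrite !inE.
Qed.

(** * Intersection numbers from the Fourier transform *)

Section DualScheme.
Variables (C : numClosedFieldType) (p : nat) (z : C) (n : nat).
Hypotheses (p_prime : prime p) (z_prim : p.-primitive_root z).
Local Notation E := 'rV['F_p]_n.
Local Notation chi := (@add_char C p z).
Local Notation fourier := (@fourier_transform C p z n).

(** With s = x - u and t = u - y, the count is over solutions of s + t = x - y, detected by summing
    [chi (dot a (s + t + (y - x)))] over a. *)
Lemma fourier_convolution (P Q : pred E) (x y : E) :
  (p ^ n)%:R * #|[set u | P (x - u) && Q (u - y)]|%:R =
  fourier (fun a => fourier (fun s => (P s)%:R) a * fourier (fun s => (Q s)%:R) a) (y - x).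
Proof.
transitivity (\sum_s \sum_t \sum_a
   (P s)%:R * (Q t)%:R * chi (dot a (s + t + (y - x)))); last first.
  under eq_bigr do rewrite exchange_big /=.
  rewrite exchange_big /=; apply: eq_bigr => a _; rewrite big_distrlr /= mulr_suml.
  apply: eq_bigr => s _; rewrite mulr_suml; apply: eq_bigr => t _.
  by rewrite !dotDr !chiD // [dot t a]dotC [dot s a]dotC; ring.
under [RHS]eq_bigr => s _ do under eq_bigr => t _ do
  rewrite -mulr_sumr (sum_chi_full p_prime z_prim).
rewrite exchange_big /= -sum1_card natr_sum mulr_sumr [LHS]big_mkcond /=.
rewrite [RHS](reindex_inj (addIr (- y))) /=; apply: eq_bigr => u _.
rewrite (bigD1 (x - u)) //= big1 ?addr0 => [|s su]; last first.
  suff /negPf -> : s + (u - y) + (y - x) != 0 by rewrite !mulr0.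
  apply: contra su; rewrite -[s == _]subr_eq0 opprB.
  by rewrite -[s + _ + _]addrA [u - y + _]addrA subrK.
have -> : x - u + (u - y) + (y - x) = 0.
  by rewrite [x - u + _]addrA subrK [x - y + _]addrA subrK subrr.
rewrite eqxx inE; case: (P _); case: (Q _) => /=; ring.
Qed.

(** Transforms of indicators of classes for f are class functions for g by the second duality; so
    are their products, which the first duality takes back to class functions for f. Evenness of the
    labels reconciles y - x with x - y. *)
Lemma dual_scheme (A B : {set E}) (f g : E -> 'F_p) :
  is_subspace A -> is_subspace B ->
  fourier_dual z A g B f -> fourier_dual z B f A g ->
  orth A \subset B -> {in orth A, forall u, f u = 0} ->
  orth B \subset A -> {in orth B, forall u, g u = 0} ->
  (forall x, f (- x) = f x) ->
  (forall L, exists x, class_label B (orth A) f x = L) ->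
  induces_symmetric_scheme (2 * p + 1)
    [set fibre (class_label B (orth A) f) L | L : bool + bool * 'F_p].
Proof.
move=> subA subB dAB dBA oAB f0 oBA g0 fN surj.
have orthN u : (- u \in orth A) = (u \in orth A).
  apply/orthP/orthP => h a /h; last by rewrite dotNr => ->; rewrite oppr0.
  by rewrite dotNr => /eqP; rewrite oppr_eq0 => /eqP.
have pn0 : (p ^ n)%:R != 0 :> C by rewrite pnatr_eq0 -lt0n expn_gt0 prime_gt0.
have lN x : class_label B (orth A) f (- x) = class_label B (orth A) f x.
  by rewrite /class_label oppr_eq0 orthN fN subspaceN.
apply: label_scheme => //.
(* The 2 + 2p labels include that of 0, which gives the diagonal relation and is not counted among
   the 2p + 1 classes. *)
- by rewrite card_sum card_prod card_bool card_Fp //; lia.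
- move=> x /(class_labelP oAB f0) [+ _ _ _].
  by rewrite eqxx => /eqP.
move=> s t x y x' y' xy.
apply/eqP; rewrite -(eqr_nat C) -(inj_eq (mulfI pn0)); apply/eqP.
rewrite (fourier_convolution (fun v => class_label B (orth A) f v == s)
  (fun v => class_label B (orth A) f v == t)).
rewrite (fourier_convolution (fun v => class_label B (orth A) f v == s)
  (fun v => class_label B (orth A) f v == t)).
apply: (fourier_class p_prime z_prim subA subB dAB) => //; last first.
  by rewrite -lN opprB xy -lN opprB.
move=> a b ab; congr (_ * _).
  by apply: (fourier_label_class p_prime z_prim subB subA dBA).
by apply: (fourier_label_class p_prime z_prim subB subA dBA).
Qed.
End DualScheme.

(** * Bent functions *)

Section Bent.
Variables (R : realType) (p n : nat).
Hypotheses (p_prime : prime p) (p_odd : odd p) (n_even : ~~ odd n).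
Local Notation E := 'rV['F_p]_n.
Local Notation C := (R[i])%C.
Local Notation z := (xi R p).
Local Notation chi := (@add_char C p z).
Local Notation walsh := (@walsh R p n).
Local Notation dual := (@dual R p n).
Local Notation Bplus := (@Bplus R p n).
Local Notation Bminus := (@Bminus R p n).
Local Notation q := (p%:R ^+ n./2 : C).
Implicit Types (f g : E -> 'F_p) (x a : E).

Lemma xi_exp k :
  z ^+ k = (cos (k%:R * (2 * pi / p%:R)) +i* sin (k%:R * (2 * pi / p%:R)))%C :> C.
Proof.
elim: k => [|k IH]; first by rewrite expr0 mul0r cos0 sin0.
rewrite exprSr IH /xi; set t := 2 * pi / p%:R.
rewrite -[k.+1%:R]natr1 [(_ + 1) * t]mulrDl mul1r cosD sinD.
by apply/eqP; rewrite eq_complex /=; apply/andP; split; apply/eqP; ring.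
Qed.

(** The order of [xi] divides the prime p, and it is not 1 because sin (2 pi / p) is positive for p
    > 2. *)
Lemma xi_prim : p.-primitive_root z.
Proof.
have p_gt2 : (2 < p)%N by apply: odd_prime_gt2.
have p0 : p%:R != 0 :> R by rewrite pnatr_eq0 -lt0n prime_gt0.
have zp : z ^+ p = 1.
  by rewrite xi_exp mulrC mulfVK // mulr_natl cos2pi sin2pi.
have [m m_prim m_p] := prim_order_exists (prime_gt0 p_prime) zp.
have /orP[/eqP m1|/eqP mp] := (primeP p_prime).2 _ m_p; last first.
  by rewrite -[X in X.-primitive_root _]mp.
move: m_prim; rewrite m1 => /prim_expr_order; rewrite expr1 /xi => -[_ s0].
suff: 0 < sin (2 * pi / p%:R : R) by rewrite s0 ltxx.
have p_gt0 : 0 < p%:R :> R by rewrite ltr0n prime_gt0.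
apply: sin_gt0_pi; rewrite divr_gt0 ?mulr_gt0 ?pi_gt0 //=.
by rewrite ltr_pdivrMr // mulrC ltr_pM2l ?pi_gt0 // ltr_nat.
Qed.

Lemma mu_even : mu R p n = 1.
Proof.
rewrite /mu -(odd_double_half n) (negPf n_even) add0n -muln2 mulnC expnM.
suff /eqP pp : p ^ 2 == 1 %[mod 4] by rewrite -modnXm pp modnXm exp1n eqxx.
rewrite -(odd_double_half p) p_odd; move: p./2 => k.
have -> : ((true + k.*2) ^ 2 = (k * k + k) * 4 + 1)%N by rewrite -muln2; nia.
by rewrite modnMDl.
Qed.

Lemma sqrtq_even : sqrtq R p n = q.
Proof.
rewrite /sqrtq -[in LHS](odd_double_half n) (negPf n_even) add0n -muln2 mulnC exprM.
by rewrite sqr_sqrtr ?ler0n // rmorphXn rmorph_nat.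
Qed.

Lemma walshE f a : walsh f a = \sum_x chi (f x - dot a x).
Proof. by []. Qed.

Lemma q_neq0 : q != 0.
Proof. by rewrite expf_neq0 // pnatr_eq0 -lt0n prime_gt0. Qed.

Lemma qq : q * q = (p ^ n)%:R.
Proof.
by rewrite -exprD addnn -natrX; congr (_ ^ _)%:R; rewrite -[RHS](odd_double_half n) (negPf n_even).
Qed.

(** By [cyclint_norm_ppow] the search in [dual] succeeds; membership in [Bplus] records the sign, as
    [q * chi k] differs from its opposite. *)
Lemma walsh_dual f a : bent R f ->
  walsh f a = (-1) ^+ (a \notin Bplus f) * (q * chi (dual f a)).
Proof.
move=> bf; have [||j [b]] := @cyclint_norm_ppow _ p z p_prime xi_prim (walsh f a) n./2.
- by apply: cyclint_sum => x _; apply: cyclint_chi.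
- by rewrite bf sqrtq_even.
have jp : (j < (Zp_trunc (pdiv p)).+2)%N by rewrite Fp_cast.
have -> : z ^+ j = chi (Ordinal jp) by [].
rewrite inE mu_even sqrtq_even mul1r /Defs.dual mu_even sqrtq_even mul1r.
case: pickP => [k|/(_ (Ordinal jp)) + W]; last first.
  by rewrite W; case: b W => W; rewrite ?expr1 ?expr0 ?mulN1r ?mul1r eqxx ?orbT.
rewrite [odflt _ _]/= => /orP[]/eqP kE _; rewrite kE ?eqxx ?mul1r //.
have /negPf -> : - (q * chi k) != q * chi k.
  rewrite eq_sym -addr_eq0 -mulr2n mulrn_eq0 negb_or /= mulf_neq0 ?q_neq0 //.
  exact: chi_neq0 xi_prim _.
by rewrite expr1 mulN1r.
Qed.

Lemma BminusE f : bent R f -> Bminus f = ~: Bplus f.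
Proof.
move=> bf; apply/setP => a; rewrite in_setC.
have W := walsh_dual a bf; move: W; rewrite [a \in Bminus f]inE mu_even sqrtq_even mul1r.
case: (a \notin Bplus f) => ->; first by rewrite expr1 mulN1r eqxx.
rewrite expr0 mul1r -addr_eq0 -mulr2n mulrn_eq0 /=.
by apply/negbTE/mulf_neq0; rewrite ?q_neq0 //; apply: chi_neq0 xi_prim _.
Qed.

Lemma eq_walsh f g : f =1 g -> walsh f =1 walsh g.
Proof. by move=> fg a; apply: eq_bigr => x _; rewrite fg. Qed.

Lemma eq_dual f g : f =1 g -> dual f =1 dual g.
Proof.
move=> fg a; rewrite /Defs.dual; congr (odflt _ _); apply: eq_pick => j.
by rewrite (eq_walsh fg).
Qed.

Lemma eq_Bplus f g : f =1 g -> Bplus f = Bplus g.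
Proof.
by move=> fg; apply/setP => a; rewrite !inE (eq_walsh fg) (eq_dual fg).
Qed.

Lemma sum_Bplus_Bminus f x : bent R f ->
  \sum_(a in Bplus f) chi (dual f a + dot a x) -
  \sum_(a in ~: Bplus f) chi (dual f a + dot a x) = q * chi (f x).
Proof.
move=> bf; apply: (mulfI q_neq0); rewrite mulrA qq.
transitivity (\sum_a walsh f a * chi (dot a x)).
  rewrite [RHS](bigID (mem (Bplus f))) /= mulrBr !mulr_sumr -sumrN.
  congr (_ + _); first by apply: eq_bigr => a aB;
    rewrite walsh_dual // aB expr0 mul1r chiD // ?mulrA //; apply: xi_prim.
  apply: eq_big => a; first by rewrite in_setC.
  rewrite in_setC => aB; rewrite walsh_dual // aB expr1 chiD ?xi_prim //.
  by rewrite mulN1r mulNr mulrA.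
transitivity (\sum_y \sum_a chi (f y) * chi (dot a (x - y))).
  rewrite exchange_big /=; apply: eq_bigr => a _.
  rewrite walshE mulr_suml; apply: eq_bigr => y _.
  by rewrite -!chiD ?xi_prim //; congr (add_char _ _); rewrite dotDr dotNr; ring.
under eq_bigr do rewrite -mulr_sumr (sum_chi_full p_prime xi_prim).
rewrite (bigD1 x) //= subrr eqxx mulr1 big1 ?addr0 1?mulrC // => y yx.
by rewrite subr_eq0 eq_sym (negPf yx) !mulr0.
Qed.

Lemma odd_ppow : ~~ (2 %| (p ^ n./2)%:Z)%Z.
Proof. by rewrite dvdzE /= dvdn2 oddX p_odd orbT. Qed.

Lemma q_intE : q = (p ^ n./2)%:Z%:~R.
Proof. by rewrite -natrX. Qed.

Lemma sum_Bplus f x : bent R f -> bent R (dual f) ->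
  [/\ dual (dual f) (- x) = f x,
      \sum_(a in Bplus f) chi (dual f a + dot a x) =
        q * chi (f x) * (- x \in Bplus (dual f))%:R
    & \sum_(a in ~: Bplus f) chi (dual f a + dot a x) =
        - q * chi (f x) * (- x \notin Bplus (dual f))%:R].
Proof.
move=> bf bg; have D := sum_Bplus_Bminus x bf.
have S : \sum_(a in Bplus f) chi (dual f a + dot a x) +
    \sum_(a in ~: Bplus f) chi (dual f a + dot a x) = walsh (dual f) (- x).
  rewrite walshE [RHS](bigID (mem (Bplus f))) /=; congr (_ + _); apply: eq_big => a.
  - by [].
  - by rewrite dotNl opprK dotC.
  - by rewrite in_setC.
  - by rewrite dotNl opprK dotC.
rewrite walsh_dual // in S.
set Sp := \sum_(a in Bplus f) _ in D S *; set Sm := \sum_(a in ~: _) _ in D S *.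
set b := - x \notin _ in S *.
(* Adding the difference [D] and the sum [S] of [Sp] and [Sm] gives twice [Sp]; as q is odd,
   [chi_parity] then identifies the two exponents. *)
have SpE : 2 * Sp = q * (chi (f x) + (-1) ^+ b * chi (dual (dual f) (- x))).
  by rewrite mulrDr -D mulrCA -S; ring.
have fx : f x = dual (dual f) (- x).
  apply: (chi_parity p_prime xi_prim (b := b) p_odd odd_ppow (y := Sp)).
    by apply: cyclint_sum => a _; apply: cyclint_chi.
  by rewrite -q_intE SpE.
rewrite -fx in SpE *.
have two0 : 2 != 0 :> C by rewrite pnatr_eq0.
have SpE' : Sp = q * chi (f x) * (~~ b)%:R.
  apply: (mulfI two0); rewrite SpE; case: (b); rewrite /= ?expr0 ?expr1; ring.
split => //; first by rewrite SpE' negbK.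
have -> : Sm = Sp - q * chi (f x) by rewrite -D; ring.
by rewrite SpE'; case: (b); rewrite /=; ring.
Qed.

(** Pairing x with - x shows that [walsh f 0] is 1 modulo 2. It is also [chi (dual f 0)] modulo 2
    since q is odd, and [chi_parity] compares the two. *)
Lemma dual0 f : bent R f -> f 0 = 0 -> (forall x, f (- x) = f x) -> dual f 0 = 0.
Proof.
(* [H] contains one element of each pair x, - x with x nonzero, chosen by the order of
   enumeration. *)
move=> bf f0 fN; pose H := [pred x : E | (enum_rank x < enum_rank (- x))%N].
have sum_half : \sum_x chi (f x) = 1 + 2 * \sum_(x in H) chi (f x).
  rewrite (bigID (mem H)) /= [X in _ + X](bigD1 0) /=; last by rewrite inE /= oppr0 ltnn.
  rewrite f0 (chi0 p_prime xi_prim) addrCA; congr (_ + _).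
  rewrite mulr2n mulrDl !mul1r; congr (_ + _).
  rewrite (reindex_inj oppr_inj) /=; apply: eq_big => x; last by rewrite fN.
  rewrite oppr_eq0 !inE /= opprK -leqNgt ltn_neqAle andbC; congr (_ && _).
  congr (~~ _); apply/eqP/eqP => [->|/val_inj/enum_rank_inj xN]; first by rewrite oppr0.
  apply/eqP; have : x *+ 2 == 0 by rewrite mulr2n {1}xN addNr.
  rewrite -scaler_nat scaler_eq0 => /orP[/eqP two0|//].
  have := chi_nat p_prime xi_prim 2; rewrite two0 (chi0 p_prime xi_prim) => /eqP.
  by rewrite eq_sym -(prim_order_dvd xi_prim) gtnNdvd // odd_prime_gt2.
have W := walsh_dual 0 bf; move: W; rewrite walshE.
under eq_bigr do rewrite dot0l subr0.
rewrite sum_half; set y := \sum_(x in H) _; set b := 0 \notin _ => W.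
have yZ : cyclint z y by apply: cyclint_sum => x _; apply: cyclint_chi.
have qodd : q = 1 + 2 * ((p ^ n./2)./2)%:R.
  rewrite -natrX -[in LHS](odd_double_half (p ^ n./2)) oddX p_odd orbT natrD -mul2n.
  by rewrite natrM.
(* The even part of q is moved into the multiple of 2, which leaves N = 1. *)
apply: (chi_parity p_prime xi_prim (N := 1) (b := ~~ b)
  (y := (-1) ^+ b * (y - (-1) ^+ b * ((p ^ n./2)./2)%:R * chi (dual f 0)))) => //.
  apply: cyclintM.
    by rewrite -(rmorph_sign (intr : int -> C)); apply: cyclint_int.
  apply: cyclintD => //; apply/cyclintN/cyclintM; last exact: cyclint_chi.
  rewrite -(rmorph_sign (intr : int -> C)); apply: cyclintM; first exact: cyclint_int.
  exact: cyclint_nat.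
have W2 : 2 * y = (-1) ^+ b * (q * chi (dual f 0)) - 1 by rewrite -W; ring.
rewrite (chi0 p_prime xi_prim) mulr1 mul1r mulrCA mulrBr W2 qodd.
by case: (b); rewrite /= ?expr0 ?expr1; ring.
Qed.

(** * Homogeneity of the dual function and Galois conjugation *)

Definition dilation_stable f := forall s, s != 0 -> exists c, forall x, f (s *: x) = c * f x.

(** With [a = s * a ^+ h], substituting [a *: y] for y turns [walsh f x] into the conjugate of
    [walsh f (s *: x)] by [a ^+ h]. Both have the same sign because [Bplus f] is a subspace, so the
    exponents agree. *)
Lemma dual_dilation f h : bent R f -> is_subspace (Bplus f) ->
  coprime (h - 1) (p - 1) -> (0 < h)%N ->
  (forall (a : 'F_p) x, a != 0 -> f (a *: x) = a ^+ h * f x) -> dilation_stable (dual f).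
Proof.
move=> bf sB hp h0 fh s s0.
have [a a0 sE] : exists2 a : 'F_p, a != 0 & a = s * a ^+ h.
  have p1 : (0 < p - 1)%N by rewrite subn_gt0 prime_gt1.
  have h1 : (0 < h - 1)%N.
    move: hp; case: (h - 1)%N => // hp; move: hp; rewrite /coprime gcd0n => /eqP p2.
    by move: p_odd; rewrite -(subnK (prime_gt0 p_prime)) p2.
  (* Bezout gives u (h - 1) = v (p - 1) + 1, and the order of s divides p - 1, so the u-th power of
     the inverse of s solves [a = s * a ^+ h]. *)
  have [u v uv _] := egcdnP (p - 1) h1; rewrite (eqP hp) in uv.
  have sp : s ^+ (p - 1) = 1.
    apply: (mulfI s0); rewrite mulr1 -exprS subn1 prednK ?prime_gt0 //.
    by have := expf_card s; rewrite card_Fp.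
  exists (s^-1 ^+ u); first by rewrite expf_neq0 ?invr_eq0.
  rewrite -exprM -(subnK h0) mulnDr muln1 uv !exprD expr1.
  by rewrite mulnC exprM [_ ^+ (p - 1)]exprVn sp invr1 expr1n mul1r mulrA mulfV // mul1r.
exists (a ^+ h)^-1 => x.
have ah0 : a ^+ h != 0 by rewrite expf_neq0.
apply: (mulfI ah0); rewrite mulrA mulfV // mul1r.
have W1 : walsh f x = \sum_y chi (a ^+ h * (f y - dot (s *: x) y)).
  rewrite walshE (reindex_inj (scalerI a0)) /=; apply: eq_bigr => y _.
  congr (add_char _ _); rewrite fh // dotZl dotZr mulrBr mulrA; congr (_ - _ * _).
  by rewrite {1}sE mulrC.
have W2 : walsh f (s *: x) =
    ((-1) ^+ (s *: x \notin Bplus f) * (p ^ n./2)%:Z)%:~R * chi (dual f (s *: x)).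
  by rewrite walsh_dual // intrM rmorph_sign q_intE mulrA.
have := chi_conjugate p_prime xi_prim (A := predT) ah0 W2.
rewrite -W1 walsh_dual // intrM rmorph_sign -q_intE subspaceZ_eq // -mulrA.
have sign_neq0 (b : bool) : (-1) ^+ b != 0 :> C by rewrite signr_eq0.
by move/(mulfI (sign_neq0 _))/(mulfI q_neq0)/(chi_inj p_prime xi_prim).
Qed.

(** Conjugating by t the formula at [t^-1 *: x] restores the term [dot a x]. As [f (t^-1 *: x)] is a
    multiple of [f x] by a constant and B is stable under dilations, the result depends on x as
    required. *)
Lemma sum_Bplus_dual f g A B : 
  is_subspace A -> is_subspace B -> dilation_stable f ->
  (forall x, \sum_(a in A) chi (g a + dot a x) = q * chi (f x) * (x \in B)%:R) ->
  (forall x, \sum_(a in ~: A) chi (g a + dot a x) = - q * chi (f x) * (x \notin B)%:R) ->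
  fourier_dual z A g B f.
Proof.
move=> sA sB f_dil SA SCA t t0.
have tV0 : t^-1 != 0 by rewrite invr_eq0.
have [c cE] := f_dil _ tV0.
have conj (D : {set E}) (N : int) x :
    \sum_(a in D) chi (g a + dot a (t^-1 *: x)) = N%:~R * chi (f (t^-1 *: x)) ->
    \sum_(a in D) chi (t * g a + dot a x) = N%:~R * chi (t * (c * f x)).
  move=> /(chi_conjugate p_prime xi_prim t0); rewrite cE => <-.
  apply: eq_bigr => a _; rewrite mulrDr dotZr mulrA mulfV ?mul1r //.
have tVB x : (t^-1 *: x \in B) = (x \in B) by rewrite subspaceZ_eq ?invr_eq0.
split.
  exists (fun u => q * chi (t * (c * u))) => x.
  rewrite (conj _ ((p ^ n./2)%:Z * (x \in B)%:Z)).
    by rewrite intrM -q_intE -pmulrn mulrAC.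
  by rewrite SA tVB intrM -q_intE -pmulrn mulrAC.
exists (fun u => - q * chi (t * (c * u))) => x.
rewrite (conj _ (- (p ^ n./2)%:Z * (x \notin B)%:Z)).
  by rewrite intrM mulrNz -q_intE -pmulrn in_setC mulrAC.
by rewrite SCA tVB intrM mulrNz -q_intE -pmulrn mulrAC.
Qed.

(** The sum over A is the same at u in [orth A] as at 0, where it is q; comparing the right-hand
    sides gives both claims. *)
Lemma orth_sub_of_sum (f g : E -> 'F_p) (A B : {set E}) :
  is_subspace B -> f 0 = 0 ->
  (forall x, \sum_(a in A) chi (g a + dot a x) = q * chi (f x) * (x \in B)%:R) ->
  orth A \subset B /\ {in orth A, forall u, f u = 0}.
Proof.
move=> sB f0 SA; suff main u : u \in orth A -> u \in B /\ f u = 0.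
  by split; [apply/subsetP => u /main [] | move=> u /main []].
move=> /orthP uA; have := SA u.
under eq_bigr => a aA do rewrite uA // -(dot0r a).
rewrite SA f0 (chi0 p_prime xi_prim) subspace0 // -!mulrA => /(mulfI q_neq0).
rewrite mulr1; case: (u \in B); last by rewrite mulr0 => /eqP; rewrite oner_eq0.
by rewrite mulr1 -(chi0 p_prime xi_prim) => /(chi_inj p_prime xi_prim).
Qed.

(** In [fourier_level] at x = 0, the term t = 0 is [#|B|], and the others add up to c times the sum
    of [chi (- (t * j))] over t != 0. *)
Lemma card_level (f : E -> 'F_p) (B : {set E}) (c : C) j :
  (forall t : 'F_p, t != 0 -> \sum_(a in B) chi (t * f a) = c) ->
  p%:R * #|[set a in B | f a == j]|%:R =
  #|B|%:R + c * (p%:R * (j == 0)%:R - 1).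
Proof.
move=> cE; have := fourier_level p_prime xi_prim B f j 0.
rewrite /fourier_transform; under eq_bigr do rewrite dot0r (chi0 p_prime xi_prim) mulr1.
have -> : \sum_a ((a \in B) && (f a == j))%:R = #|[set a in B | f a == j]|%:R :> C.
  rewrite -sum1_card natr_sum [RHS]big_mkcond; apply: eq_bigr => a _.
  by rewrite inE; case: (_ && _).
move=> ->; rewrite (bigD1 0) //= mul0r oppr0 (chi0 p_prime xi_prim) mul1r.
congr (_ + _).
  rewrite -sum1_card natr_sum; apply: eq_bigr => a _.
  by rewrite mul0r dot0r addr0 (chi0 p_prime xi_prim).
under eq_bigr => t t0.
  under eq_bigr do rewrite dot0r addr0.
  rewrite cE //.
  over.
rewrite /= -mulr_suml mulrC; congr (_ * _).
apply/eqP; rewrite eq_sym subr_eq addrC -[X in _ == X + _](chi0 p_prime xi_prim).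
rewrite -[X in chi X + _]oppr0 -[X in chi (- X) + _](mul0r j).
rewrite -(bigD1 0 (P := predT) (F := fun t => chi (- (t * j)))) //=.
have [->|j0] := eqVneq j 0.
  rewrite mulr1 (eq_bigr (fun=> 1)) => [|t _]; last by rewrite mulr0 oppr0 chi0 ?xi_prim.
  by rewrite sumr_const card_Fp.
rewrite (reindex_inj (mulIf (_ : - j^-1 != 0))) /=; last by rewrite oppr_eq0 invr_eq0.
under eq_bigr do rewrite mulrN mulNr opprK mulfVK //.
by rewrite (sum_chi_Fp p_prime xi_prim) mulr0.
Qed.

(** By [card_level], each level outside B has (p^n - p^r) / p elements, positive since r < n. Inside
    B, a level j != 0 has (p^r - p^(n/2)) / p, positive since r > n/2, and the level 0 has (p^r + (p
    - 1) p^(n/2)) / p, more than the p^(n - r) elements of [orth A]. *)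
Lemma class_label_surj (f : E -> 'F_p) (A B : {set E}) r :
  is_subspace A -> is_subspace B -> #|A| = (p ^ r)%N -> #|B| = (p ^ r)%N ->
  (n./2 < r)%N -> (r < n)%N ->
  orth A \subset B -> {in orth A, forall u, f u = 0} ->
  (forall t : 'F_p, t != 0 -> \sum_(a in B) chi (t * f a) = q) ->
  (forall t : 'F_p, t != 0 -> \sum_(a in ~: B) chi (t * f a) = 0) ->
  forall L, exists x, class_label B (orth A) f x = L.
Proof.
move=> sA sB cA cB mr rn AB f0 SB SCB.
have p_gt1 := prime_gt1 p_prime.
have cO : #|orth A| = (p ^ (n - r))%N.
  have := card_orth p_prime xi_prim sA; rewrite cA -[in X in _ = X](subnKC (ltnW rn)).
  by rewrite expnD => /eqP; rewrite eqn_pmul2l ?expn_gt0 ?prime_gt0 // => /eqP.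
have lab x b j : x \notin orth A -> (x \in B) = ~~ b -> f x = j ->
    class_label B (orth A) f x = inr (b, j).
  move=> xA xB <-; rewrite /class_label (negPf xA) xB negbK ifN //.
  by apply: contraNneq xA => ->; apply: orth0.
case=> [[]|[[] j]].
- by exists 0; rewrite /class_label eqxx.
- have [x xA x0] : exists2 x, x \in orth A & x != 0.
    have : (0 < #|orth A :\ 0%R|)%N.
      have : (1 < #|orth A|)%N by rewrite cO -[1%N](expn0 p) ltn_exp2l // subn_gt0.
      by rewrite (cardsD1 0%R) orth0.
    by case/card_gt0P => x; rewrite in_setD1 => /andP[x0 xA]; exists x.
  by exists x; rewrite /class_label (negPf x0) xA.
- have cD := card_level j SCB; rewrite mul0r addr0 in cD.
  have [x] : exists x, x \in [set a in ~: B | f a == j].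
    apply/card_gt0P; rewrite lt0n; apply/eqP => c0.
    move: cD => /eqP; rewrite c0 mulr0 eq_sym pnatr_eq0 => /eqP cB0.
    have := cardsC B; rewrite cB0 addn0 cB card_space // => /eqP.
    by rewrite eqn_exp2l // => /eqP rn'; rewrite rn' ltnn in rn.
  rewrite inE in_setC => /andP[xB /eqP xj]; exists x; apply: lab => //.
    by apply: contra xB; apply: (subsetP AB).
  exact/negbTE.
have cD := card_level j SB; rewrite cB in cD.
suff [x] : exists x, x \in [set a in B | f a == j] :\: orth A.
  rewrite in_setD => /andP[xA]; rewrite inE => /andP[xB /eqP xj].
  by exists x; apply: lab => //; rewrite xB.
apply/set0Pn/negP => /eqP D0.
have sub : [set a in B | f a == j] \subset orth A by rewrite -setD_eq0 D0.
have lt_pm : (p ^ n./2 < p ^ r)%N by rewrite ltn_exp2l.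
move: cD; have [j0|j0] := eqVneq j 0.
  rewrite mulr1 -natrX -natrM => cD.
  have {}cD : (p * #|[set a in B | f a == j]| + p ^ n./2 = p ^ r + p ^ n./2 * p)%N.
    by apply/eqP; rewrite -(eqr_nat C) !natrD !natrM; apply/eqP; rewrite -natrM cD; ring.
  have := subset_leq_card sub; rewrite cO => le_c.
  have : (p * p ^ (n - r) <= p ^ n./2)%N.
    rewrite -expnS leq_exp2l //; have := odd_double_half n; rewrite (negPf n_even).
    by move: mr rn; rewrite -mul2n; lia.
  by move: le_c cD lt_pm; rewrite -(leq_pmul2l (prime_gt0 p_prime)); nia.
have -> : [set a in B | f a == j] = set0.
  apply/setP => x; rewrite in_set0; apply/negP => xB; have := f0 x (subsetP sub x xB).
  by move: xB j0; rewrite inE => /andP[_ /eqP ->] /eqP.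
rewrite cards0 !mulr0 sub0r mulrN1 -natrX => /eqP; rewrite eq_sym subr_eq0 eqr_nat.
by rewrite gtn_eqF.
Qed.

End Bent.

(** * The family [U1] as the set of fibres of the class label *)

Theorem theorem1 (R : realType) (p n r : nat) (f : 'rV['F_p]_n -> 'F_p)
    (p_prime : prime p) (p_odd : odd p)
    (n_ge4 : (4 <= n)%N) (n_even : ~~ odd n)
    (f_nwr : non_weakly_regular R f) (f_DBF : DBF R f)
    (Bf : nondeg_subspace r (Bplus R f))
    (Bfs : nondeg_subspace r (Bplus R (dual R f)))
    (r_ge : (n %/ 2 + 1 <= r)%N) (r_le : (r <= n - 1)%N) :
  partition (U1 R f) [set: 'rV['F_p]_n] /\
  induces_symmetric_scheme (2 * p + 1) (U1 R f).
Proof.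
have [[bf bg] f0 [h [h_gt0 h_co fh]]] := f_DBF.
have z_prim := xi_prim R p_prime p_odd.
set g := dual R f in bg Bfs *; set A := Bplus R f in Bf *; set B := Bplus R g in Bfs *.
have [sA cA] : is_subspace A /\ #|A| = (p ^ r)%N.
  have [W [-> <- _]] := Bf; split; first by exists W.
  by rewrite cardsE card_vspace card_Fp.
have [sB cB] : is_subspace B /\ #|B| = (p ^ r)%N.
  have [W [-> <- _]] := Bfs; split; first by exists W.
  by rewrite cardsE card_vspace card_Fp.
have p1 : (p - 1 = (p./2).*2)%N by rewrite -{1}(odd_double_half p) p_odd addKn.
(* For odd h, 2 would divide both h - 1 and p - 1. An even h makes f an even function. *)
have h_even : ~~ odd h.
  apply/negP => h_odd; move: h_co; rewrite /coprime p1 -(odd_double_half h) h_odd addKn.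
  by rewrite -!muln2 -muln_gcdl => /eqP; lia.
have fN x : f (- x) = f x.
  rewrite -scaleN1r fh ?oppr_eq0 ?oner_eq0 // -signr_odd (negPf h_even) expr0 mul1r //.
have g_dil : dilation_stable g := dual_dilation p_prime p_odd n_even bf sA h_co h_gt0 fh.
have f_dil : dilation_stable f by move=> s s0; exists (s ^+ h) => x; apply: fh.
(* As f is even, the dual of g is f, so all formulas also hold with (f, B) and (g, A) exchanged. *)
have gg : dual R g =1 f.
  move=> x; have [+ _ _] := sum_Bplus p_prime p_odd n_even (- x) bf bg.
  by rewrite opprK fN.
have bgg : bent R (dual R g) by move=> a; rewrite (eq_walsh R gg).
have BgA : Bplus R (dual R g) = A := eq_Bplus R gg.
have sumA x := sum_Bplus p_prime p_odd n_even x bf bg.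
have sumB x := sum_Bplus p_prime p_odd n_even x bg bgg.
pose chi := @add_char _ p (xi R p); pose q : R[i]%C := p%:R ^+ n./2.
have SA x : \sum_(a in A) chi (g a + dot a x) = q * chi (f x) * (x \in B)%:R.
  by have [_ -> _] := sumA x; rewrite subspaceN.
have SCA x : \sum_(a in ~: A) chi (g a + dot a x) = - q * chi (f x) * (x \notin B)%:R.
  by have [_ _ ->] := sumA x; rewrite subspaceN.
have SB x : \sum_(a in B) chi (f a + dot a x) = q * chi (g x) * (x \in A)%:R.
  have [_ + _] := sumB x; rewrite BgA subspaceN // => <-.
  by apply: eq_bigr => a _; rewrite gg.
have SCB x : \sum_(a in ~: B) chi (f a + dot a x) = - q * chi (g x) * (x \notin A)%:R.
  have [_ _] := sumB x; rewrite BgA subspaceN // => <-.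
  by apply: eq_bigr => a _; rewrite gg.
have g0 : g 0 = 0 by apply: dual0.
have [oAB fA0] := orth_sub_of_sum p_prime p_odd sB f0 SA.
have [oBA gB0] := orth_sub_of_sum p_prime p_odd sA g0 SB.
have dAB := sum_Bplus_dual p_prime p_odd sA sB f_dil SA SCA.
have dBA := sum_Bplus_dual p_prime p_odd sB sA g_dil SB SCB.
have surj : forall L, exists x, class_label B (orth A) f x = L.
  apply: (class_label_surj (R := R) p_prime p_odd n_even sA sB cA cB) => //.
  - by move: r_ge; rewrite divn2 addn1.
  - by move: r_le n_ge4; lia.
  (* At x = 0 and t = 1 the sums over B and its complement are q and 0, because 0 lies in A and
     [g 0 = 0]; these are integers, so conjugation gives the same values for every t != 0. *)
  - move=> t t0; have E0 : \sum_(a in B) chi (f a) = (p ^ n./2)%:Z%:~R * chi 0.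
      transitivity (q * chi (g 0) * (0 \in A)%:R).
        by rewrite -SB; apply: eq_bigr => a _; rewrite dot0r addr0.
      by rewrite g0 subspace0 // mulr1 -q_intE.
    rewrite [LHS](chi_conjugate p_prime z_prim t0 E0).
    by rewrite mulr0 (chi0 p_prime z_prim) mulr1 -q_intE.
  - move=> t t0; have E0 : \sum_(a in ~: B) chi (f a) = 0%:~R * chi 0.
      transitivity (- q * chi (g 0) * (0 \notin A)%:R).
        by rewrite -SCB; apply: eq_bigr => a _; rewrite dot0r addr0.
      by rewrite subspace0 // mulr0 mul0r.
    by rewrite [LHS](chi_conjugate p_prime z_prim t0 E0) mul0r.
have U1E : U1 R f = [set fibre (class_label B (orth A) f) L | L : bool + bool * 'F_p].
  have f1 : fibre (class_label B (orth A) f) (inl true) = [set 0].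
    apply/setP => x; rewrite !inE /class_label; case: (x == 0) => //.
    by case: ifP.
  have f2 : fibre (class_label B (orth A) f) (inl false) = orth A :\ 0.
    apply/setP => x; rewrite in_setD1 inE /class_label; case: (x == 0) => //.
    by case: ifP.
  have f3 j : fibre (class_label B (orth A) f) (inr (false, j)) = cset R f j :\: orth A.
    apply/setP => x; rewrite in_setD inE /class_label; have [->|_] := eqVneq x 0.
      by rewrite orth0.
    case: ifP => // _; rewrite [x \in cset R f j]inE -/g -/B /=.
    by rewrite (inj_eq (@inr_inj _ _)) xpair_eqE eqbF_neg negbK.
  have f4 j : fibre (class_label B (orth A) f) (inr (true, j)) = dset R f j.
    apply/setP => x; rewrite inE [x \in dset R f j]inE (BminusE p_prime p_odd n_even bg).
    rewrite in_setC -/B /class_label; have [->|_] := eqVneq x 0.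
      by rewrite subspace0.
    case: ifP => [xA|_]; first by rewrite (subsetP oAB).
    by rewrite (inj_eq (@inr_inj _ _)) xpair_eqE eqb_id.
  (* Since f vanishes on [orth A], only the class with j = 0 meets it, and only there does the set
     difference in [U1] matter. *)
  have f5 j : j != 0 -> cset R f j :\: orth A = cset R f j.
    move=> j0; apply/setP => x; rewrite in_setD; case xA: (x \in orth A) => //=.
    by rewrite inE fA0 // eq_sym (negPf j0) andbF.
  apply/setP => S; rewrite /U1 -/A; apply/idP/imsetP.
    rewrite in_setU [S \in _ :|: [set _ | _ in _ & _]]in_setU -orbA => /or3P[].
    - rewrite in_setU in_setU !in_set1 -orbA => /or3P[]/eqP ->.
      + by exists (inl true).
      + by exists (inl false).
      + by exists (inr (false, 0)).
    - case/imsetP => j; rewrite inE => j0 ->; exists (inr (false, j)) => //.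
      by rewrite f3 f5.
    - by case/imsetP => j _ ->; exists (inr (true, j)).
  case=> [[[]|[[] j]] _ ->]; rewrite ?f1 ?f2 ?f3 ?f4.
  - by rewrite !inE eqxx.
  - by rewrite !in_setU !in_set1 eqxx !orbT.
  - by apply/setUP; right; apply: imset_f.
  - have [->|j0] := eqVneq j 0; first by rewrite !in_setU !in_set1 eqxx !orbT.
    apply/setUP; left; apply/setUP; right; rewrite f5 //.
    by apply: imset_f; rewrite inE.
rewrite U1E; split; first exact: fibre_partition.
by apply: (dual_scheme p_prime z_prim sA sB dAB dBA).
Qed.
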